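(* There exist constants $0<c_0\le c_1$ such that for every $x\in\mathcal{SG}\setminus V_0$, every $k$, and every $k$ level mean value neighborhood $B$ of $x$, $$c_0\,5^{-k}\le c_B\le c_1\,5^{-k}.$$
   Context: Let $q_0,q_1,q_2$ be the vertices of an equilateral triangle in $\mathbb{R}^2$ and $F_i(z)=\frac12(z+q_i)$. The Sierpinski gasket $\mathcal{SG}$ is the unique nonempty compact set with $\mathcal{SG}=\bigcup_{i=0}^2F_i(\mathcal{SG})$. For $w\in\{0,1,2\}^m$, $F_w=F_{w_1}\circ\cdots\circ F_{w_m}$ and $C_w=F_w(\mathcal{SG})$ is an $m$-cell with boundary points $F_wq_i$. $V_0=\{q_0,q_1,q_2\}$, $V_m=\bigcup_{|w|=m}F_w(V_0)$, $x\sim_my$ means $x\ne y$ lie in a common $F_w(V_0)$, $|w|=m$. $\mu$ is the self-similar probability measure giving mass $3^{-m}$ to each $m$-cell. Energy: $\mathcal{E}(u)=\lim_m(5/3)^m\sum_{x\sim_my}(u(x)-u(y))^2$, $\mathrm{dom}\,\mathcal{E}$ the continuous $u$ with finite energy; $u\in\mathrm{dom}\,\Delta$ with $\Delta u=f$ if $f$ is continuous, $u\in\mathrm{dom}\,\mathcal{E}$ and $\mathcal{E}(u,\varphi)=-\int f\varphi\,d\mu$ for all $\varphi\in\mathrm{dom}\,\mathcal{E}$ vanishing on $V_0$. Harmonic functions: continuous $h$ with $h(x)=\frac14\sum_{y\sim_mx}h(y)$ for all $m\ge1$, $x\in V_m\setminus V_0$. $M_B(h)=\frac1{\mu(B)}\int_Bh\,d\mu$.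 For a cell $C_w$ with $C_w\cap V_0=\emptyset$, boundary points $p_i=F_wq_i$: $C_i$ is the unique other cell of the same level containing $p_i$; $\rho$ is the height of the triangle $F_w(\mathrm{conv}\,V_0)$; for $c_i\in[0,1]$, with $u_i$ the unit vector at $p_i$ along the symmetry axis of the triangle of $C_i$ pointing into $C_i$, $E_i=\{z\in C_i:\langle z-p_i,u_i\rangle\le c_i\rho\}$, and $B(c_0,c_1,c_2)=C_w\cup E_0\cup E_1\cup E_2$. For $x\in C_w$, such a set $B$ is a $k$ level mean value neighborhood of $x$ if $|w|=k$ and $M_B(h)=h(x)$ for every harmonic $h$. Let $v$ be the function with $\Delta v\equiv1$, $v|_{V_0}=0$; $c_B=M_B(v)-v(x)$. *)

(* Defs.v *)
From HB Require Import structures.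
From mathcomp Require Import all_boot all_order all_algebra.
From mathcomp Require Import all_classical all_reals all_analysis.
Set Implicit Arguments. Unset Strict Implicit. Unset Printing Implicit Defensive.
Import Order.TTheory GRing.Theory Num.Theory.
Import numFieldNormedType.Exports.
Local Open Scope classical_set_scope.
Local Open Scope ring_scope.

Section SG.
Variable R : realType.
Notation pt := (R * R)%type.

Definition inner (a b : pt) : R := a.1 * b.1 + a.2 * b.2.
Definition psub (a b : pt) : pt := (a.1 - b.1, a.2 - b.2).
Definition edist (a b : pt) : R := Num.sqrt (inner (psub a b) (psub a b)).

Definition equilateral (q : 'I_3 -> pt) : Prop :=
  q ord0 != q (inord 1) /\
  edist (q ord0) (q (inord 1)) = edist (q (inord 1)) (q (inord 2)) /\
  edist (q (inord 1)) (q (inord 2)) = edist (q (inord 2)) (q ord0).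

Variable q : 'I_3 -> pt.

Definition F (i : 'I_3) (z : pt) : pt :=
  ((z.1 + (q i).1) / 2, (z.2 + (q i).2) / 2).

Definition Fw (w : seq 'I_3) (z : pt) : pt := foldr F z w.

Definition is_SG (K : set pt) : Prop :=
  compact K /\ K !=set0 /\ K = [set y | exists i z, K z /\ y = F i z].

Variable K : set pt.

Definition cell (w : seq 'I_3) : set pt := Fw w @` K.

Definition in_V (m : nat) (x : pt) : Prop :=
  exists (w : m.-tuple 'I_3) (i : 'I_3), x = Fw w (q i).

Definition nbrs (m : nat) (x : pt) : seq pt :=
  undup [seq Fw (tval wj.1) (q wj.2) | wj : m.-tuple 'I_3 * 'I_3 <- enum predT &
          [exists i, Fw (tval wj.1) (q i) == x] && (Fw (tval wj.1) (q wj.2) != x)].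

Definition harmonic (h : pt -> R) : Prop :=
  {within K, continuous h} /\
  forall (m : nat) (x : pt), (1 <= m)%N -> in_V m x -> ~ in_V 0 x ->
    h x = 4^-1 * \sum_(y <- nbrs m x) h y.

(* the m-th energy sums, over the edges x ~_m y (each edge lies in exactly
   one m-cell) *)
Definition Em2 (m : nat) (u phi : pt -> R) : R :=
  (5 / 3) ^+ m * \sum_(w : m.-tuple 'I_3) \sum_(i < 3) \sum_(j < 3 | (i < j)%N)
    (u (Fw w (q i)) - u (Fw w (q j))) * (phi (Fw w (q i)) - phi (Fw w (q j))).

Definition domE (u : pt -> R) : Prop :=
  {within K, continuous u} /\ exists l : R, (fun m => Em2 m u u) @ \oo --> l.

Variable mu : {measure set pt -> \bar R}.

Definition has_lap (u f : pt -> R) : Prop :=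
  {within K, continuous f} /\ domE u /\
  forall phi : pt -> R, domE phi -> (forall i, phi (q i) = 0) ->
    (fun m => Em2 m u phi) @ \oo --> - (Rintegral mu K (fun z => f z * phi z)).

Definition meanB (B : set pt) (h : pt -> R) : R :=
  (fine (mu B))^-1 * Rintegral mu B h.

Definition height (w : seq 'I_3) : R :=
  edist (Fw w (q ord0)) (Fw w (q (inord 1))) * Num.sqrt 3 / 2.
Definition centroid (w : seq 'I_3) : pt :=
  (((Fw w (q ord0)).1 + (Fw w (q (inord 1))).1 + (Fw w (q (inord 2))).1) / 3,
   ((Fw w (q ord0)).2 + (Fw w (q (inord 1))).2 + (Fw w (q (inord 2))).2) / 3).
(* unit vector at p along the symmetry axis of the triangle of C_{w'}
   (through its vertex p), pointing into C_{w'} *)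
Definition axis_unit (w' : seq 'I_3) (p : pt) : pt :=
  let d := psub (centroid w') p in
  (d.1 / edist (centroid w') p, d.2 / edist (centroid w') p).
Definition Eset (w : seq 'I_3) (w' : seq 'I_3) (p : pt) (c : R) : set pt :=
  [set z | cell w' z /\ inner (psub z p) (axis_unit w' p) <= c * height w].
Definition Bset (w : seq 'I_3) (w' : 'I_3 -> seq 'I_3) (c : 'I_3 -> R) : set pt :=
  cell w `|` \bigcup_(i in [set: 'I_3]) Eset w (w' i) (Fw w (q i)) (c i).

(* B = Bset w w' c is a (size w) level mean value neighborhood of x *)
Definition mvn (x : pt) (w : seq 'I_3) (w' : 'I_3 -> seq 'I_3) (c : 'I_3 -> R) : Prop :=
  (forall i, ~ cell w (q i)) /\
  (forall i, size (w' i) = size w /\ w' i != w /\ cell (w' i) (Fw w (q i))) /\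
  (forall i, 0 <= c i <= 1) /\
  cell w x /\
  forall h, harmonic h -> meanB (Bset w w' c) h = h x.

End SG.

(* Main.v *)
(* On a cell [F_w] any solution of [Delta v = 1] is the harmonic extension of its
   three corner values plus [5^-k v], and at a junction point of two [k]-cells
   the sum of the four neighboring values is [4 v(p) + 2/3 5^-k]. The set [B] is
   symmetric in each neighboring cell, so integrals over [B] only see that sum and
   hence only the values at the corners of [C_w]. Subtracting the mean value
   property of the harmonic part gives, with normalized quantities,
     [c_B 5^k = (I + sum_i (V_i + 2/3 D_i)) / s - v(F_w^-1 x)],
   where [s] is the mass of [B], [I] and [V_i] are the integrals of [v] over
   [C_w] and [E_i], and [D_i] is the integral over [E_i] of the harmonic
   coordinate of a far vertex. Upper bounds are immediate. For the lower bound
   [V_i >= - D_i / 3] and [- v >= (1 - sum_l h_l^2) / 12], with [h_l] the harmonic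
   coordinates; these coordinates at [F_w^-1 x] are determined by the masses and
   the [D_i], and what remains is a polynomial inequality, strict because some
   harmonic coordinate is at least 2/5 at every point. *)

Require Import Defs.
From HB Require Import structures.
From mathcomp Require Import all_boot all_order all_algebra.
From mathcomp Require Import all_classical all_reals all_analysis.
From mathcomp Require Import perm measurable_realfun ring lra.
Import Order.TTheory GRing.Theory Num.Theory.
Import numFieldNormedType.Exports.
Set Implicit Arguments. Unset Strict Implicit. Unset Printing Implicit Defensive.
Local Open Scope classical_set_scope.
Local Open Scope ring_scope.

(** * The triangle and its barycentric coordinates *)

(** The measure is available only through the masses of the cells; self-similarity of integrals and
    invariance under reflections have to be derived. Means over cells are therefore indexed by the
    word of the cell, and the facts about them (the mean of a harmonic coordinate, the symmetry of a
    truncated cell, the bound for the mean of [v]) are proved for all words at once by one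
    principle: a bounded family of defects cannot be positive anywhere if every common bound [M]
    improves to [r * M] with a fixed [r < 1]. Subdividing a cell provides the improvement. The same
    principle on points of [K] gives the pointwise bounds for [v], with comparison functions that
    one subdivision reproduces up to a term of the right sign. The weak Laplacian is used only once:
    against a piecewise harmonic tent at a junction point the energy sums become stationary, which
    yields the midpoint rule [hext]. From there on a function enters through its vertex values and
    continuity, and the argument is finite linear algebra on cells. *)

Definition o0 : 'I_3 := @Ordinal 3 0 isT.
Definition o1 : 'I_3 := @Ordinal 3 1 isT.
Definition o2 : 'I_3 := @Ordinal 3 2 isT.

Lemma I3_case (P : 'I_3 -> Prop) : P o0 -> P o1 -> P o2 -> forall i, P i.
Proof.
move=> P0 P1 P2 [[|[|[|m]]] Hi] //.
- by rewrite (_ : Ordinal Hi = o0) //; apply: val_inj.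
- by rewrite (_ : Ordinal Hi = o1) //; apply: val_inj.
- by rewrite (_ : Ordinal Hi = o2) //; apply: val_inj.
Qed.

Lemma sum_I3 (V : zmodType) (f : 'I_3 -> V) : \sum_(i < 3) f i = f o0 + f o1 + f o2.
Proof.
rewrite !big_ord_recl big_ord0 addr0 addrA.
by congr (f _ + f _ + f _); apply: val_inj.
Qed.

Lemma inord_o1 : inord 1 = o1 :> 'I_3. Proof. by apply: val_inj; rewrite /= inordK. Qed.
Lemma inord_o2 : inord 2 = o2 :> 'I_3. Proof. by apply: val_inj; rewrite /= inordK. Qed.

Section Geometry.
Variable R : realType.
Notation pt := (R * R)%type.
Variable q : 'I_3 -> pt.
Hypothesis qE : equilateral q.

Definition side2 : R := inner (psub (q o0) (q o1)) (psub (q o0) (q o1)).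

Definition barycenter : pt :=
  (((q o0).1 + (q o1).1 + (q o2).1) / 3, ((q o0).2 + (q o1).2 + (q o2).2) / 3).

(* normalized by [<q i - q j, barycenter - q j> = side2 / 2] for [i != j] *)
Definition bary (j : 'I_3) (z : pt) : R :=
  1 - 2 / side2 * inner (psub z (q j)) (psub barycenter (q j)).

Lemma inner_self_ge0 (a : pt) : 0 <= inner a a.
Proof. by rewrite /inner -!expr2 addr_ge0 ?sqr_ge0. Qed.

Lemma edist_inj_sq (a b c d : pt) : Defs.edist a b = Defs.edist c d ->
  inner (psub a b) (psub a b) = inner (psub c d) (psub c d).
Proof.
rewrite /Defs.edist => /(congr1 (fun x => x ^+ 2)).
by rewrite !sqr_sqrtr ?inner_self_ge0.
Qed.

Lemma sides : [/\ inner (psub (q o0) (q o1)) (psub (q o0) (q o1)) = side2,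
  inner (psub (q o1) (q o2)) (psub (q o1) (q o2)) = side2 &
  inner (psub (q o2) (q o0)) (psub (q o2) (q o0)) = side2].
Proof.
have := qE; rewrite /equilateral inord_o1 inord_o2 => -[_ [h1 h2]].
have e0 : ord0 = o0 by apply: val_inj.
rewrite e0 in h1 h2.
have h1' := edist_inj_sq h1; have h2' := edist_inj_sq h2.
by split; rewrite /side2; congruence.
Qed.

Lemma side2_gt0 : 0 < side2.
Proof.
have [+ _] := qE; rewrite inord_o1 (_ : ord0 = o0); last exact: val_inj.
move=> ne; rewrite lt_neqAle inner_self_ge0 andbT eq_sym /side2.
apply/eqP; rewrite /inner /= -!expr2 => /eqP.
rewrite paddr_eq0 ?sqr_ge0 // !sqrf_eq0 !subr_eq0 => /andP[/eqP h1 /eqP h2].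
by case/eqP: ne; rewrite (surjective_pairing (q o0)) h1 h2 -surjective_pairing.
Qed.

Lemma bary_q j i : bary j (q i) = (i == j)%:R.
Proof.
have [h1 h2 h3] := sides; have L0 := side2_gt0; rewrite /bary.
have HL (t : R) (b : bool) : t = (~~ b)%:R * side2 / 2 -> 1 - 2 / side2 * t = b%:R.
  by move=> ->; case: b => /=; field; rewrite gt_eqF.
apply: HL; rewrite /inner /barycenter /psub /= in h1 h2 h3 *.
by move: i; apply: I3_case; move: j; apply: I3_case => /=; lra.
Qed.

Lemma bary_F j i z : bary j (F q i z) = (bary j z + (i == j)%:R) / 2.
Proof. by rewrite -bary_q /bary /F /inner /psub /=; field; rewrite gt_eqF ?side2_gt0. Qed.

Lemma sum_bary z : \sum_(j < 3) bary j z = 1.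
Proof.
have [] := sides; have := side2_gt0; rewrite sum_I3 /bary; move: side2 => L L0 h1 h2 h3.
have HL (a b c : R) : a + b + c = L -> 1 - 2 / L * a + (1 - 2 / L * b) + (1 - 2/L * c) = 1.
  move=> h; rewrite (_ : 1 - 2 / L * a + (1 - 2 / L * b) + (1 - 2/L * c) = 3 - 2 / L * (a + b + c)); last by ring.
  by rewrite h; field; rewrite gt_eqF.
apply: HL; rewrite /inner /barycenter /psub /= in h1 h2 h3 *. lra.
Qed.

Lemma bary_inj z z' : (forall j, bary j z = bary j z') -> z = z'.
Proof.
move=> h; have [] := sides; have L0 := side2_gt0.
have h' j : inner (psub z z') (psub barycenter (q j)) = 0.
  have /eqP := h j; rewrite /bary -subr_eq0 => /eqP e.
  have : 2 / side2 * inner (psub z z') (psub barycenter (q j)) = 0.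
    by rewrite -[RHS]oppr0 -[in RHS]e /inner /psub /=; ring.
  by move/eqP; rewrite mulf_eq0 mulf_eq0 invr_eq0 pnatr_eq0 /= gt_eqF //= => /eqP.
have := h' o0; have := h' o1; have := h' o2.
rewrite /barycenter /inner /psub /=.
case: z z' {h h'} => [z1 z2] [w1 w2] /=.
set a := (q o1).1 - (q o0).1; set b := (q o1).2 - (q o0).2.
set c := (q o2).1 - (q o0).1; set d := (q o2).2 - (q o0).2.
move=> e2 e1 e0 h1 h2 h3.
have f1 : (z1 - w1) * a + (z2 - w2) * b = 0 by rewrite /a /b; lra.
have f2 : (z1 - w1) * c + (z2 - w2) * d = 0 by rewrite /c /d; lra.
have ga : a ^+ 2 + b ^+ 2 = side2 by rewrite /a /b; lra.
have gc : c ^+ 2 + d ^+ 2 = side2 by move: h3; rewrite /c /d => ?; lra.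
have gac : a * c + b * d = side2 / 2 by move: h1 h2 h3; rewrite /a /b /c /d => ? ? ?; lra.
(* Lagrange's identity: the Gram determinant of two sides meeting at 60 degrees is nonzero, so the
   two orthogonality relations force the difference to vanish. *)
have gd : (a * d - b * c) ^+ 2 = 3 / 4 * side2 ^+ 2.
  transitivity ((a ^+ 2 + b ^+ 2) * (c ^+ 2 + d ^+ 2) - (a * c + b * d) ^+ 2); first by ring.
  by rewrite ga gc gac; field.
have D0 : a * d - b * c != 0.
  by rewrite -sqrf_eq0 gd mulf_neq0 // ?sqrf_eq0 ?gt_eqF //; lra.
have g1 : (z1 - w1) * (a * d - b * c) = 0.
  transitivity (d * ((z1 - w1) * a + (z2 - w2) * b) - b * ((z1 - w1) * c + (z2 - w2) * d)); first by ring.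
  by rewrite f1 f2; ring.
have g2 : (z2 - w2) * (a * d - b * c) = 0.
  transitivity (a * ((z1 - w1) * c + (z2 - w2) * d) - c * ((z1 - w1) * a + (z2 - w2) * b)); first by ring.
  by rewrite f1 f2; ring.
move/eqP: g1; rewrite mulf_eq0 (negPf D0) orbF subr_eq0 => /eqP ->.
by move/eqP: g2; rewrite mulf_eq0 (negPf D0) orbF subr_eq0 => /eqP ->.
Qed.

Lemma bary1_q z j : (forall i, 0 <= bary i z) -> 1 <= bary j z -> z = q j.
Proof.
move=> h0 h1; apply: bary_inj => i; rewrite bary_q.
have := sum_bary z; rewrite sum_I3 => hs.
have hz := (h0 o0, h0 o1, h0 o2); case: hz => -[ha hb] hc; move: h1.
by move: j; apply: I3_case; move: i; apply: I3_case => /= h1; lra.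
Qed.

Lemma F_q i : F q i (q i) = q i.
Proof. by apply: bary_inj => j; rewrite bary_F bary_q; lra. Qed.

Lemma F_qC i j : F q i (q j) = F q j (q i).
Proof. by apply: bary_inj => k; rewrite !bary_F !bary_q addrC. Qed.

Definition Finv (i : 'I_3) (z : pt) : pt := (2 * z.1 - (q i).1, 2 * z.2 - (q i).2).

Lemma FK i : cancel (F q i) (Finv i).
Proof. by case=> a b; rewrite /F /Finv /=; congr pair; field. Qed.

Lemma FinvK i : cancel (Finv i) (F q i).
Proof. by case=> a b; rewrite /F /Finv /=; congr pair; field. Qed.

Lemma Fw_cat u t z : Fw q (u ++ t) z = Fw q u (Fw q t z).
Proof. by rewrite /Fw foldr_cat. Qed.

Lemma Fw_rcons u i z : Fw q (rcons u i) z = Fw q u (F q i z).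
Proof. by rewrite -cats1 Fw_cat. Qed.

Definition Fwinv (w : seq 'I_3) (z : pt) : pt := foldl (fun y i => Finv i y) z w.

Lemma FwK w : cancel (Fw q w) (Fwinv w).
Proof. by elim: w => [|i w ih] z //=; rewrite FK ih. Qed.

Lemma Fwinv_rcons u i z : Fwinv (rcons u i) z = Finv i (Fwinv u z).
Proof. by rewrite /Fwinv -cats1 foldl_cat. Qed.

Lemma Fw_nseq n i : Fw q (nseq n i) (q i) = q i.
Proof. by elim: n => //= n ->; rewrite F_q. Qed.

Lemma psub_Fw w a b :
  psub (Fw q w a) (Fw q w b) = (2 ^- size w * (psub a b).1, 2 ^- size w * (psub a b).2).
Proof.
elim: w => [|i w ih]; first by rewrite /psub /= expr0 invr1 !mul1r.
case: ih => e1 e2; rewrite /= exprS invfM -!mulrA -e1 -e2.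
by rewrite /psub /F /=; congr pair; field.
Qed.

End Geometry.

(** * The attractor and the adjacency of its cells *)

Section Contraction.
Variable R : realType.

Lemma geometric_small (r M e : R) : 0 <= r < 1 -> 0 < e -> exists n, M * r ^+ n < e.
Proof.
move=> /andP[r0 r1] e0.
have : (fun n => M * r ^+ n) @ \oo --> M * 0.
  by apply: cvgMr; apply: cvg_expr; rewrite ger0_norm.
rewrite mulr0 => /cvgr_lt /(_ _ e0) [n _ h]; exists n; exact: (h n (leqnn n)).
Qed.

(** Iterating the hypothesis [m] times improves an arbitrary a priori bound by the factor [r ^+ m].
    In the applications [T] consists of points of [K], of words, or of words with a truncation
    level. *)
Lemma contraction_le0 (T : Type) (g : T -> R) (r : R) : 0 <= r < 1 ->
  (exists M, forall t, g t <= M) ->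
  (forall M, 0 <= M -> (forall t, g t <= M) -> forall t, g t <= r * M) ->
  forall t, g t <= 0.
Proof.
move=> /andP[r0 r1] [M hM] hr t; rewrite leNgt; apply/negP => gt0.
have [n hn] := @geometric_small r (Num.max M 0) (g t) (introT andP (conj r0 r1)) gt0.
suff h m : forall u, g u <= Num.max M 0 * r ^+ m by have := h n t; rewrite leNgt hn.
elim: m => [|m ih] u; first by rewrite expr0 mulr1 le_max hM.
by rewrite exprS mulrCA; apply: hr => //; rewrite mulr_ge0 ?exprn_ge0 // le_max lexx orbT.
Qed.

End Contraction.

Section Attractor.
Variable R : realType.
Notation pt := (R * R)%type.
Variable q : 'I_3 -> pt.
Hypothesis qE : equilateral q.
Variable K : set pt.
Hypothesis KE : is_SG q K.

Lemma K_F i z : K z -> K (F q i z).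
Proof. by have [_ [_ e]] := KE; rewrite {2}e => Kz; exists i, z. Qed.

Lemma K_Fw w z : K z -> K (Fw q w z).
Proof. by elim: w => //= i w ih /ih; apply: K_F. Qed.

Lemma K_split z : K z -> exists i y, K y /\ z = F q i y.
Proof. by have [_ [_ e]] := KE; rewrite {1}e. Qed.

Lemma K_address n z : K z -> exists w y, [/\ size w = n, K y & z = Fw q w y].
Proof.
elim: n z => [|n ih] z Kz; first by exists [::], z.
have [i [y [Ky ->]]] := K_split Kz; have [w [y' [<- Ky' ->]]] := ih _ Ky.
by exists (i :: w), y'.
Qed.

Lemma bary_continuous j : continuous (bary q j).
Proof.
move=> z; rewrite /bary /inner /=; apply: cvgB; first exact: cvg_cst.
apply: cvgMr; apply: cvgD; apply: cvgMl; apply: cvgB; try exact: cvg_cst.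
- exact: cvg_fst.
- exact: cvg_snd.
Qed.

Lemma compact_attains_max (f : pt -> R) : {within K, continuous f} ->
  exists2 c, K c & forall z, K z -> f z <= f c.
Proof.
move=> cf; have [cK [K0 _]] := KE.
have [c /set_mem Kc h] := compact_EVT_max K0 cK cf; exists c => // z Kz.
by apply: h; exact/mem_set.
Qed.

Lemma compact_abs_bounded (f : pt -> R) : {within K, continuous f} ->
  exists M, forall z, K z -> `|f z| <= M.
Proof.
move=> cf; have cn : {within K, continuous (fun z => `|f z|)}.
  by move=> z; apply: cvg_norm; exact: cf.
by have [c _ h] := compact_attains_max cn; exists (`|f c|).
Qed.

Lemma K_contraction (f : pt -> R) (r : R) : 0 <= r < 1 -> {within K, continuous f} ->
  (forall M, 0 <= M -> (forall z, K z -> f z <= M) -> forall z, K z -> f z <= r * M) ->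
  forall z, K z -> f z <= 0.
Proof.
move=> hr cf h z Kz; have [M hM] := compact_abs_bounded cf.
apply: (@contraction_le0 R {z | K z} (fun z => f (sval z)) r hr _ _ (exist _ z Kz)).
  by exists M => -[y Ky] /=; exact: le_trans (ler_norm _) (hM _ Ky).
move=> N N0 hN [y Ky] /=; apply: h => // x Kx; exact: (hN (exist _ x Kx)).
Qed.

Lemma bary_ge0 z j : K z -> 0 <= bary q j z.
Proof.
move=> Kz; rewrite -oppr_le0; move: z Kz.
apply: (@K_contraction _ 2^-1); first lra.
  by apply: continuous_subspaceT => z; apply: cvgN; exact: bary_continuous.
move=> M M0 hM z /K_split[i [y [Ky ->]]]; rewrite bary_F //.
by have := hM _ Ky; case: (i == j) => /= h; lra.
Qed.

Lemma bary_le1 z j : K z -> bary q j z <= 1.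
Proof.
move=> Kz; have := sum_bary qE z; rewrite sum_I3.
have := bary_ge0 o0 Kz; have := bary_ge0 o1 Kz; have := bary_ge0 o2 Kz.
by move: j; apply: I3_case => *; lra.
Qed.

(** At a maximum point of [bary i] on [K], applying [F i] averages the value with 1 and cannot
    increase it, so the maximum is at least 1; only the vertex [q i] attains that. *)
Lemma K_q i : K (q i).
Proof.
have [c Kc h] := compact_attains_max (continuous_subspaceT (@bary_continuous i)).
have := h _ (K_F i Kc); rewrite bary_F // eqxx /= => h1.
rewrite -(bary1_q qE (z := c) (j := i)) //; last by lra.
by move=> j; exact: bary_ge0.
Qed.

(** Comparing [bary j] on both sides gives [bary j y = bary j z + 1], which is at least 1 and so
    pins [y] to [q j]; likewise for [z]. *)
Lemma F_meet i j y z : i != j -> K y -> K z -> F q i y = F q j z -> y = q j /\ z = q i.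
Proof.
move=> ij Ky Kz e; split; apply: (bary1_q qE).
- by move=> k; exact: bary_ge0.
- have := congr1 (bary q j) e; rewrite !bary_F // eqxx (negPf ij) /=.
  by have := bary_ge0 j Kz => *; lra.
- by move=> k; exact: bary_ge0.
- have := congr1 (bary q i) e; rewrite !bary_F // eqxx eq_sym (negPf ij) /=.
  by have := bary_ge0 i Ky => *; lra.
Qed.

Lemma F_eq_q i j y : K y -> F q i y = q j -> i = j /\ y = q j.
Proof.
move=> Ky e; have [ij|ij] := eqVneq i j.
  by split => //; apply: (can_inj (FK q i)); rewrite e ij F_q.
have := F_meet ij Ky (K_q j); rewrite F_q // => /(_ e)[_ e'].
by have := bary_q qE i i; rewrite -e' bary_q // eqxx eq_sym (negPf ij) => /eqP; rewrite eq_sym oner_eq0.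
Qed.

Lemma q_inj i j : q i = q j -> i = j.
Proof. by move=> e; have [] := @F_eq_q i j (q i) (K_q i); rewrite ?F_q. Qed.

Lemma Fw_eq_q t y i : K y -> Fw q t y = q i -> t = nseq (size t) i /\ y = q i.
Proof.
move=> Ky; elim: t => //= a t ih /F_eq_q[]; first exact: K_Fw.
by move=> -> /ih[<- ->].
Qed.

(* Two digits are possible only at junction points, so a glued function is
   well behaved on [K] as soon as its pieces agree there. *)
Definition digit (z : pt) : 'I_3 :=
  if 2^-1 <= bary q o0 z then o0 else if 2^-1 <= bary q o1 z then o1 else o2.

Definition glueF (T : Type) (f : 'I_3 -> pt -> T) (z : pt) : T :=
  f (digit z) (Finv q (digit z) z).

Lemma digit_q i : digit (q i) = i.
Proof.
have hT : (2^-1 <= (1 : R)) by lra.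
have hF : (2^-1 <= (0 : R)) = false by apply/negbTE; rewrite -ltNge; lra.
by rewrite /digit !bary_q //; move: i; apply: I3_case => /=; rewrite ?hT ?hF.
Qed.

(** A digit other than [i] is chosen only if [y] is the vertex named by that digit, and there the
    compatibility hypothesis identifies the two pieces. *)
Lemma glueFE (T : Type) (f : 'I_3 -> pt -> T) i y :
  (forall i j, f i (q j) = f j (q i)) -> K y -> glueF f (F q i y) = f i y.
Proof.
move=> fC Ky; rewrite /glueF; have [->|di] := eqVneq (digit (F q i y)) i; first by rewrite FK.
suff e : y = q (digit (F q i y)).
  by move: e di; move: (digit _) => k -> _; rewrite F_qC // FK fC.
apply: (bary1_q qE) => [j|]; first exact: bary_ge0.
suff : 2^-1 <= bary q (digit (F q i y)) (F q i y).
  by rewrite bary_F // eq_sym (negPf di) /= => ?; lra.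
rewrite /digit; case: ifP => // h0; case: ifP => // h1.
have /eqP : i = o2; last by move=> i2; move: di; rewrite /digit h0 h1 eq_sym i2.
move: h0 h1 {di}; rewrite !bary_F //; have := bary_ge0 o0 Ky; have := bary_ge0 o1 Ky.
move: i; apply: I3_case => //= h1 h0 /negbT; rewrite -ltNge => g0 /negbT; rewrite -ltNge => g1.
all: exfalso; lra.
Qed.

Lemma glueF_q (T : Type) (f : 'I_3 -> pt -> T) i : glueF f (q i) = f i (q i).
Proof. by rewrite /glueF digit_q (_ : Finv q i (q i) = q i) // -{1}(F_q qE i) FK. Qed.

(** After a common prefix [u], two neighboring words of equal length read [a b ... b] and
    [b a ... a]: both cells contain the image under [u] of the midpoint of the side from [q a] to
    [q b]. The indices name the vertex of each cell that sits at this point. *)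
Inductive adj : seq 'I_3 -> 'I_3 -> seq 'I_3 -> 'I_3 -> Prop :=
| adj_split a b n of a != b : adj (a :: nseq n b) b (b :: nseq n a) a
| adj_cons c w i w' j of adj w i w' j : adj (c :: w) i (c :: w') j.

Lemma adj_size w i w' j : adj w i w' j -> size w = size w'.
Proof. by elim=> [a b n ab|c {}w {}i {}w' {}j _ /= ->] //=; rewrite !size_nseq. Qed.

Lemma adj_Fw w i w' j : adj w i w' j -> Fw q w (q i) = Fw q w' (q j).
Proof.
by elim=> [a b n ab|c {}w {}i {}w' {}j _ /= -> //]; rewrite /= !Fw_nseq // F_qC.
Qed.

Lemma adj_neq w i w' j : adj w i w' j -> w != w'.
Proof.
elim=> [a b n ab|c {}w {}i {}w' {}j _ h]; first by rewrite eqseq_cons (negPf ab).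
by rewrite eqseq_cons eqxx.
Qed.

Lemma cell_meet w w' y y' : size w = size w' -> w != w' -> K y -> K y' ->
  Fw q w y = Fw q w' y' -> exists i j, [/\ adj w i w' j, y = q i & y' = q j].
Proof.
move=> + + Ky Ky'; elim: w w' => [|a w ih] [|b w'] //= [sw].
rewrite eqseq_cons; have [-> /= ww|ab _] := eqVneq a b.
  move=> /(can_inj (FK q b)) /(ih _ sw ww)[i [j [h1 h2 h3]]].
  by exists i, j; split => //; constructor.
move=> /(F_meet ab (K_Fw w Ky) (K_Fw w' Ky'))[/(Fw_eq_q Ky)[ew ey] /(Fw_eq_q Ky')[ew' ey']].
exists b, a; split => //; rewrite {1}ew {1}ew' -sw; exact: adj_split.
Qed.

Lemma adj_nseq n b w' j : ~ adj (nseq n b) b w' j.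
Proof.
move e : (nseq n b) => w; move ei : b => i h; elim: h n b e ei => {w i w' j}.
  by move=> a b n ab [|m] // c /= [ca _] cb; rewrite -ca cb eqxx in ab.
by move=> c w i w' j h ih [|n] // b [_ e] eb; exact: (ih n b).
Qed.

Lemma adj_fun w i w' j w'' j' : adj w i w' j -> adj w i w'' j' -> w' = w''.
Proof.
move=> h; elim: h w'' j' => {w i w' j} [a b n ab|c w i w' j h ih] w'' j'.
  move e : (a :: nseq n b) => w; move ei : b => i h.
  case: h e ei => {w i w'' j'} [a' b' n' ab'|c w i w' j h].
    by move=> [-> en] _; congr cons; have := congr1 size en; rewrite !size_nseq => ->.
  by move=> [_ e] ei; rewrite -e -ei in h; have := adj_nseq h.
move e : (c :: w) => x h2; case: h2 h ih e => {x i w'' j'} [a b n ab|c' w2 i w2' j2 h2] h ih [ec ew].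
  by rewrite ew in h; have := adj_nseq h.
by rewrite ec; congr cons; apply: (ih _ j2); rewrite ew.
Qed.

Lemma adj_exists w i : Fw q w (q i) = q i \/ exists w' j, adj w i w' j.
Proof.
elim: w => [|a w [e|[w' [j h]]]]; first by left.
- have [-> _] := Fw_eq_q (K_q i) e; have [->|ai] := eqVneq a i.
    by left; rewrite -[_ :: _]/(nseq (size w).+1 i) Fw_nseq.
  by right; exists (i :: nseq (size w) a), a; exact: adj_split.
- by right; exists (a :: w'), j; constructor.
Qed.

End Attractor.

(** * Harmonic coordinates *)

Section Harmonic.
Variable R : realType.
Notation pt := (R * R)%type.
Variable q : 'I_3 -> pt.
Hypothesis qE : equilateral q.
Variable K : set pt.
Hypothesis KE : is_SG q K.

Lemma within_K_continuousP (f : pt -> R) : {within K, continuous f} <->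
  forall z, K z -> forall e, 0 < e -> \forall y \near z, K y -> `|f z - f y| < e.
Proof.
split=> [/subspace_continuousP h z Kz e e0|h].
  have /cvgrPdist_lt/(_ _ e0) := h z Kz.
  by rewrite near_withinE.
apply/subspace_continuousP => z Kz; apply/cvgrPdist_lt => e e0.
by rewrite near_withinE; exact: h.
Qed.

Lemma Fw_continuous w : continuous (Fw q w).
Proof.
elim: w => [|i w ih] z /=; first exact: cvg_id.
have cF : continuous (F q i).
  have -> : F q i = (fun y => 2^-1 *: (y + q i)).
    by apply/funext => y; rewrite /F !(mulrC _ 2^-1).
  by move=> y; apply: cvgZr; apply: cvgD; [exact: cvg_id | exact: cvg_cst].
exact: (continuous_comp (ih z) (cF _)).
Qed.

Lemma within_K_comp_Fw (f : pt -> R) w :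
  {within K, continuous f} -> {within K, continuous (f \o Fw q w)}.
Proof.
move=> /within_K_continuousP h; apply/within_K_continuousP => z Kz e e0 /=.
have hn : \forall y \near z, K (Fw q w y) -> `|f (Fw q w z) - f (Fw q w y)| < e.
  exact: (@Fw_continuous w z _ (h _ (K_Fw KE w Kz) e e0)).
by apply: filterS hn => y hy Ky; apply: hy; exact: K_Fw.
Qed.

Lemma cell_closed w : closed (cell q K w).
Proof.
have [cK _] := KE; apply: compact_closed.
  exact: (@norm_hausdorff _ (R * R)%type).
by apply: continuous_compact => //; apply: continuous_subspaceT; exact: Fw_continuous.
Qed.

Lemma within_K_of_osc (f : pt -> R) :
  (forall e, 0 < e -> exists n, forall w, size w = n ->
    forall a b, K a -> K b -> `|f (Fw q w a) - f (Fw q w b)| <= e) ->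
  {within K, continuous f}.
Proof.
move=> h; apply/within_K_continuousP => z Kz e e0.
have [n hn] := h _ (divr_gt0 e0 (ltr0n R 2)).
(* There are finitely many [n]-cells and they are closed, so a neighborhood of [z] avoids those that
   miss [z]; every point of [K] in it shares an [n]-cell with [z]. *)
have : \forall y \near z, forall w : n.-tuple 'I_3, ~ cell q K w z -> ~ cell q K w y.
  apply: (@filter_forall pt _ (fun (w : n.-tuple 'I_3) (y : pt) => ~ cell q K w z -> ~ cell q K w y) (nbhs z)) => w; have [zw|zw] := pselect (cell q K w z).
    by apply: filterE => y /(_ zw).
  have oc : open (~` cell q K w) by rewrite openC; exact: cell_closed.
  have := open_nbhs_nbhs (conj oc zw).
  by apply: filterS => y hy _.
apply: filterS => y hy Ky.
have [w [a [sw Ka ya]]] := K_address KE n Ky.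
have [[b Kb zb]|zw] := pselect (cell q K w z).
  by rewrite -zb ya (le_lt_trans (hn w sw _ _ Kb Ka)) //; lra.
by have := hy (tcast sw (in_tuple w)); rewrite val_tcast /= => /(_ zw)[]; exists a.
Qed.

Lemma K_bounded : exists M, forall a b, K a -> K b -> `|a - b| <= M.
Proof.
have cn : {within K, continuous (fun z : pt => `|z|)}.
  by apply: continuous_subspaceT; exact: norm_continuous.
have [M hM] := compact_abs_bounded KE cn; exists (M + M) => a b Ka Kb.
have := hM _ Ka; have := hM _ Kb; rewrite !normr_id => h1 h2.
by apply: le_trans (ler_normB _ _) _; exact: lerD.
Qed.

Lemma cells_near (f : pt -> R) z e : {within K, continuous f} -> K z -> 0 < e ->
  exists n, forall w, size w = n -> cell q K w z ->
    forall y, K y -> `|f z - f (Fw q w y)| < e.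
Proof.
move=> /within_K_continuousP h Kz e0; have /nbhs_ballP[d /= d0 hd] := h z Kz e e0.
have [M hM] := K_bounded.
have [|n hn] := @geometric_small R 2^-1 M d _ d0; first by lra.
exists n => w sw [a Ka za] y Ky; apply: hd; last exact: K_Fw.
rewrite -ball_normE /= -za; apply: le_lt_trans hn.
have -> : Fw q w a - Fw q w y = (2^-1) ^+ n *: (a - y).
  have := psub_Fw q w a y; rewrite sw exprVn /psub => -[e1 e2].
  by rewrite [LHS]surjective_pairing [RHS]surjective_pairing /= e1 e2.
by rewrite normrZ ger0_norm ?exprn_ge0 ?invr_ge0 // mulrC ler_pM2r ?exprn_gt0 ?invr_gt0 // hM.
Qed.

Lemma within_K_eq0 (f : pt -> R) : {within K, continuous f} ->
  (forall w i, f (Fw q w (q i)) = 0) -> forall z, K z -> f z = 0.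
Proof.
move=> cf f0 z Kz; apply/eqP; rewrite -normr_eq0; apply/negPn/negP => nz.
have e0 : 0 < `|f z| by rewrite lt_neqAle eq_sym nz normr_ge0.
have [n hn] := cells_near cf Kz e0.
have [w [a [sw Ka za]]] := K_address KE n Kz.
have cw : cell q K w z by rewrite za; exists a.
by have := hn w sw cw (q o0) (K_q qE KE o0); rewrite f0 subr0 ltxx.
Qed.

(* The harmonic extension rule (2/5, 2/5, 1/5) as a linear map: values of the
   harmonic coordinates on the cell [i] from those on the whole gasket. *)
Definition hstep (i : 'I_3) (b : 'I_3 -> R) (l : 'I_3) : R :=
  if l == i then (3 * b i + 2 * \sum_(m < 3) b m) / 5
  else (b l + \sum_(m < 3) b m - b i) / 5.

Lemma sum_hstep i b : \sum_(l < 3) hstep i b l = \sum_(l < 3) b l.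
Proof. by rewrite !sum_I3 /hstep !sum_I3; move: i; apply: I3_case => /=; lra. Qed.

Lemma hstep_ge0 i b l : (forall m, 0 <= b m) -> 0 <= hstep i b l.
Proof.
move=> h; have h0 := h o0; have h1 := h o1; have h2 := h o2.
by rewrite /hstep !sum_I3; move: i; apply: I3_case; move: l; apply: I3_case => /=; lra.
Qed.

Lemma hstepB i b c l : hstep i (fun m => b m - c m) l = hstep i b l - hstep i c l.
Proof. by rewrite /hstep !sum_I3; case: ifP => _; lra. Qed.

Lemma hstep_sum i (c : 'I_3 -> R) (b : 'I_3 -> 'I_3 -> R) l :
  hstep i (fun m => \sum_(k < 3) c k * b k m) l = \sum_(k < 3) c k * hstep i (b k) l.
Proof. by rewrite /hstep !sum_I3; case: ifP => _; lra. Qed.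

(** Differences of coordinate vectors have sum zero. Eliminating [d i] by this relation turns the
    entries into [3 d_i / 5] and [(2 d_l + d_m) / 5], whose absolute values add up to at most 3/5 of
    the l1 norm. *)
Lemma hstep_contract i d : \sum_(l < 3) d l = 0 ->
  \sum_(l < 3) `|hstep i d l| <= 3 / 5 * \sum_(l < 3) `|d l|.
Proof.
move=> d0; rewrite /hstep d0 mulr0 addr0.
have bd (t : R) : - `|t| <= t <= `|t| by rewrite -ler_norml.
have H (a b c u v w t : R) : - u <= a <= u -> - v <= b <= v -> - w <= c <= w ->
    u + v + w <= t -> `|a| + `|b| + `|c| <= t.
  rewrite -!ler_norml => ha hb hc; apply: le_trans.
  by apply: lerD => //; exact: lerD.
move: d0; rewrite !sum_I3; move: i; apply: I3_case => /=; move: (d o0) (d o1) (d o2) => x y z e;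
  have /andP[x1 x2] := bd x; have /andP[y1 y2] := bd y; have /andP[z1 z2] := bd z.
- by apply: (H _ _ _ (3 * `|x| / 5) ((2 * `|y| + `|z|) / 5) ((2 * `|z| + `|y|) / 5));
    try (apply/andP; split); lra.
- by apply: (H _ _ _ ((2 * `|x| + `|z|) / 5) (3 * `|y| / 5) ((2 * `|z| + `|x|) / 5));
    try (apply/andP; split); lra.
- by apply: (H _ _ _ ((2 * `|x| + `|y|) / 5) ((2 * `|y| + `|x|) / 5) (3 * `|z| / 5));
    try (apply/andP; split); lra.
Qed.

(** The extension rule is followed along [n] digits from the center of the simplex, a start that the
    limit forgets. A finite stage still depends on the digit chosen at a junction point; the limit
    does not, which is why the step relation [hcoord_F] is stated for the limit. *)
Fixpoint hcoord_approx (n : nat) (z : pt) (l : 'I_3) : R :=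
  if n is n'.+1 then
    hstep (digit q z) (hcoord_approx n' (Finv q (digit q z) z)) l
  else 3^-1.

Lemma sum_hcoord_approx n z : \sum_(l < 3) hcoord_approx n z l = 1.
Proof. by elim: n z => [|n ih] z /=; [rewrite sum_I3; lra | rewrite sum_hstep]. Qed.

Lemma hcoord_approx_ge0 n z l : 0 <= hcoord_approx n z l.
Proof. by elim: n z l => [|n ih] z l /=; [lra | apply: hstep_ge0 => m]. Qed.

Lemma sum_norm_le2 (b c : 'I_3 -> R) : (forall l, 0 <= b l) -> (forall l, 0 <= c l) ->
  \sum_(l < 3) b l = 1 -> \sum_(l < 3) c l = 1 -> \sum_(l < 3) `|b l - c l| <= 2.
Proof.
move=> b0 c0 b1 c1; apply: (@le_trans _ _ (\sum_(l < 3) (b l + c l))).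
  apply: ler_sum => l _; apply: le_trans (ler_normB _ _) _.
  by rewrite !ger0_norm.
by rewrite big_split /= b1 c1.
Qed.

Lemma hcoord_approx_step n z :
  \sum_(l < 3) `|hcoord_approx n.+1 z l - hcoord_approx n z l| <= 2 * (3 / 5) ^+ n.
Proof.
elim: n z => [|n ih] z.
  rewrite expr0 mulr1; apply: sum_norm_le2; try exact: hcoord_approx_ge0; exact: sum_hcoord_approx.
set y := Finv q (digit q z) z.
under eq_bigr do rewrite [hcoord_approx n.+2 z _]/= [hcoord_approx n.+1 z _]/= -hstepB.
apply: le_trans (hstep_contract _ _) _.
  by rewrite sumrB -/y (sum_hcoord_approx n.+1 y) (sum_hcoord_approx n y) subrr.
by rewrite exprS mulrCA; apply: ler_wpM2l; [lra | exact: ih].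
Qed.

Definition hcoord (l : 'I_3) (z : pt) : R := limn (fun n => hcoord_approx n z l).

Lemma hcoord_cvg l z : hcoord_approx n z l @[n --> \oo] --> hcoord l z.
Proof.
set u := fun n => hcoord_approx n z l.
(* The factor 5 makes [g n - g n.+1] equal to [2 * (3 / 5) ^+ n], the bound on the increments of
   [u]; so [u + g] is nonincreasing. *)
set g := fun n => 5 * (3 / 5 : R) ^+ n.
have g0 : g @ \oo --> (0 : R).
  by rewrite -[0](mulr0 5); apply: cvgMr; apply: cvg_expr; rewrite ger0_norm; lra.
have cv : cvgn (fun n => u n + g n).
  apply: nonincreasing_is_cvgn.
    apply/nonincreasing_seqP => n.
    have h := hcoord_approx_step n z.
    have hl : `|u n.+1 - u n| <= 2 * (3 / 5) ^+ n.
      by apply: le_trans h; rewrite (bigD1 l) //= lerDl sumr_ge0.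
    have := le_trans (ler_norm _) hl; rewrite /g exprS => ?; lra.
  exists 0 => _ [n _ <-]; rewrite addr_ge0 ?hcoord_approx_ge0 //.
  by rewrite mulr_ge0 // exprn_ge0 //; lra.
suff : cvgn u by [].
have -> : u = (fun n => (u n + g n) - g n) by apply/funext => n; rewrite addrK.
by apply: is_cvgB => //; apply: cvgP g0.
Qed.

Lemma hcoord_ge0 l z : 0 <= hcoord l z.
Proof.
apply: limr_ge; first by apply/cvg_ex; exists (hcoord l z); exact: hcoord_cvg.
by apply: nearW => n; exact: hcoord_approx_ge0.
Qed.

Lemma hcoord_hstep l z :
  hcoord l z = hstep (digit q z) (hcoord^~ (Finv q (digit q z) z)) l.
Proof.
set y := Finv q _ z.
have hc m : hcoord_approx n y m @[n --> \oo] --> hcoord m y by exact: hcoord_cvg.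
have h1 : hcoord_approx n.+1 z l @[n --> \oo] --> hcoord l z.
  by rewrite (@cvg_shiftS _ (fun n => hcoord_approx n z l)); exact: hcoord_cvg.
apply: (cvg_unique _ h1) => //=; rewrite /hstep !sum_I3 -/y.
case: ifP => _; [under eq_fun do rewrite sum_I3 | under eq_fun do rewrite sum_I3].
- by apply: cvgMl; apply: cvgD; apply: cvgMr => //; apply: cvgD => //; exact: cvgD.
- by apply: cvgMl; apply: cvgB => //; apply: cvgD => //; apply: cvgD => //; exact: cvgD.
Qed.

Lemma sum_hcoord z : \sum_(l < 3) hcoord l z = 1.
Proof.
have h : \sum_(l < 3) hcoord_approx n z l @[n --> \oo] --> \sum_(l < 3) hcoord l z.
  under eq_fun do rewrite sum_I3; rewrite sum_I3.
  by apply: cvgD; [apply: cvgD|]; exact: hcoord_cvg.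
by apply: (cvg_unique _ h) => //; rewrite (_ : (fun n => _) = cst 1); [exact: cvg_cst|];
  apply/funext => n; exact: sum_hcoord_approx.
Qed.

Lemma hcoord_le1 l z : hcoord l z <= 1.
Proof. by rewrite -(sum_hcoord z) (bigD1 l) //= lerDl sumr_ge0 // => m _; exact: hcoord_ge0. Qed.

Lemma hcoord_q l i : hcoord l (q i) = (l == i)%:R.
Proof.
have h m := hcoord_hstep m (q i); have s1 := sum_hcoord (q i).
rewrite digit_q // in h; have e : Finv q i (q i) = q i by rewrite -{1}(F_q qE i) FK.
(* The vertex is fixed by its own digit, so its coordinates solve [x = (3 x + 2) / 5] and then
   [x = x / 5]. *)
rewrite e in h; have hi := h i; rewrite /hstep eqxx s1 in hi.
have [->|li] := eqVneq l i; first by rewrite /=; lra.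
by have := h l; rewrite /hstep (negPf li) s1 /= => ?; lra.
Qed.

Lemma hcoord_F l i y : K y -> hcoord l (F q i y) = hstep i (hcoord^~ y) l.
Proof.
move=> Ky; pose f i y := hstep i (hcoord^~ y).
have gE z : hcoord^~ z = glueF q f z by apply/funext => m; exact: hcoord_hstep.
rewrite -[LHS]/((hcoord^~ (F q i y)) l) gE (glueFE qE KE) // => {}i j; apply/funext => m.
rewrite /f /hstep !sum_I3 !hcoord_q; move: i; apply: I3_case; move: j; apply: I3_case;
  move: m; apply: I3_case => /=; lra.
Qed.

Lemma hcoord_Fw l w y : K y ->
  hcoord l (Fw q w y) = \sum_(m < 3) hcoord m y * hcoord l (Fw q w (q m)).
Proof.
move=> Ky; elim: w l => [|i w ih] l /=.
  rewrite (bigD1 l) //= hcoord_q eqxx mulr1 big1 ?addr0 // => m ml.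
  by rewrite hcoord_q eq_sym (negPf ml) mulr0.
rewrite hcoord_F; last exact: K_Fw.
have -> : hcoord^~ (Fw q w y) =
    (fun l => \sum_(m < 3) hcoord m y * hcoord l (Fw q w (q m))) by apply/funext => m; exact: ih.
rewrite (@hstep_sum _ (hcoord^~ y) (fun k m => hcoord m (Fw q w (q k)))).
by apply: eq_bigr => m _; rewrite hcoord_F //; exact: (K_Fw KE _ (K_q qE KE _)).
Qed.

Lemma hcoord_osc w a b : K a -> K b ->
  \sum_(l < 3) `|hcoord l (Fw q w a) - hcoord l (Fw q w b)| <= 2 * (3 / 5) ^+ size w.
Proof.
move=> Ka Kb; elim: w => [|i w ih] /=.
  by rewrite mulr1; apply: sum_norm_le2 => [l|l||]; rewrite ?hcoord_ge0 ?sum_hcoord.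
rewrite (eq_bigr (fun l => `|hstep i (fun m => hcoord m (Fw q w a) - hcoord m (Fw q w b)) l|)); last first.
  by move=> l _; rewrite hstepB !hcoord_F //; exact: (K_Fw KE).
apply: le_trans (hstep_contract _ _) _; first by rewrite sumrB !sum_hcoord subrr.
by rewrite exprS mulrCA; apply: ler_wpM2l; [lra | exact: ih].
Qed.

Lemma hcoord_continuous l : {within K, continuous (hcoord l)}.
Proof.
apply: within_K_of_osc => e e0.
have [|n hn] := @geometric_small R (3 / 5) 2 e _ e0; first by lra.
exists n => w sw a b Ka Kb; apply: le_trans (ltW hn); rewrite -sw.
by apply: le_trans (hcoord_osc w Ka Kb); rewrite (bigD1 l) //= lerDl sumr_ge0.
Qed.

(* [hext eps f]: on every cell the values of [f] at the midpoints are those of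
   the harmonic extension, lowered by [eps * 5 ^- level / 15]; for [eps = 1]
   this says that [f] has Laplacian [1]. *)
Definition hext (eps : R) (f : pt -> R) : Prop := forall w i j, i != j ->
  f (Fw q w (F q i (q j))) =
  (\sum_(l < 3) f (Fw q w (q l)) + f (Fw q w (q i)) + f (Fw q w (q j))) / 5
    - eps * 5 ^- size w / 15.

Lemma hext_hcoord l : hext 0 (hcoord l).
Proof.
move=> w i j ij; rewrite !mul0r subr0.
rewrite hcoord_Fw; last by exact: (K_F KE _ (K_q qE KE _)).
rewrite !sum_I3 !(hcoord_F _ i (K_q qE KE j)) /hstep !sum_I3 !hcoord_q.
by move: i ij; apply: I3_case; move: j; apply: I3_case => //= _; lra.
Qed.

Lemma hext_Fw eps f w : hext eps f -> hext (eps * 5 ^- size w) (f \o Fw q w).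
Proof.
move=> h u i j ij /=; under eq_bigr do rewrite -Fw_cat.
by rewrite -!Fw_cat h // size_cat exprD invfM !mulrA.
Qed.

Lemma hext_eq0 f : {within K, continuous f} -> hext 0 f -> (forall i, f (q i) = 0) ->
  forall z, K z -> f z = 0.
Proof.
move=> cf hf f0; apply: within_K_eq0 => //; elim/last_ind => [|w a ih] i; first exact: f0.
rewrite Fw_rcons; have [->|ai] := eqVneq a i; first by rewrite F_q.
by rewrite hf // sum_I3 !ih; lra.
Qed.

Lemma hext_unique eps f g : {within K, continuous f} -> {within K, continuous g} ->
  hext eps f -> hext eps g -> (forall i, f (q i) = g (q i)) -> forall z, K z -> f z = g z.
Proof.
move=> cf cg hf hg fg z Kz; apply/eqP; rewrite -subr_eq0; apply/eqP; move: z Kz.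
apply: hext_eq0; first by move=> z; apply: cvgB; [exact: cf | exact: cg].
  by move=> w i j ij; rewrite hf // hg // !sum_I3; lra.
by move=> i; rewrite fg subrr.
Qed.

Lemma within_K_hsum (c : 'I_3 -> R) :
  {within K, continuous (fun z => \sum_(l < 3) c l * hcoord l z)}.
Proof.
have -> : (fun z => \sum_(l < 3) c l * hcoord l z) =
    (fun z => c o0 * hcoord o0 z + c o1 * hcoord o1 z + c o2 * hcoord o2 z).
  by apply/funext => z; rewrite sum_I3.
move=> z.
by apply: cvgD; [apply: cvgD|]; apply: cvgMr; exact: hcoord_continuous.
Qed.

Lemma hext_hsum (c : 'I_3 -> R) : hext 0 (fun z => \sum_(l < 3) c l * hcoord l z).
Proof. by move=> w i j ij; rewrite !sum_I3 !hext_hcoord // !sum_I3; lra. Qed.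

Lemma hsum_q (c : 'I_3 -> R) i : \sum_(l < 3) c l * hcoord l (q i) = c i.
Proof.
rewrite (bigD1 i) //= hcoord_q eqxx mulr1 big1 ?addr0 // => m ml.
by rewrite hcoord_q (negPf ml) mulr0.
Qed.

Lemma hext_Fw_eq eps v f w z : {within K, continuous v} -> hext 1 v ->
  (forall i, v (q i) = 0) -> {within K, continuous f} -> hext eps f -> K z ->
  f (Fw q w z) = \sum_(l < 3) f (Fw q w (q l)) * hcoord l z + eps * 5 ^- size w * v z.
Proof.
move=> cv hv v0 cf hf; move: z; set c := fun l => f (Fw q w (q l)).
apply: (@hext_unique (eps * 5 ^- size w) (f \o Fw q w)
  (fun z => \sum_(l < 3) c l * hcoord l z + eps * 5 ^- size w * v z)).
- exact: within_K_comp_Fw.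
- move=> z; apply: cvgD; first exact: within_K_hsum.
  by apply: cvgMr; exact: cv.
- exact: hext_Fw.
- by move=> u i j ij; rewrite hext_hsum // hv // !sum_I3; lra.
- by move=> i; rewrite hsum_q v0 mulr0 addr0.
Qed.

(** Common prefixes are removed by rescaling. Both sides then obey the same recursion as the cells
    shrink to the junction point, so the balance of the first subdivision persists at every
    level. *)
Lemma hext_adj eps f w i w' j : hext eps f -> adj w i w' j ->
  \sum_(l < 3) f (Fw q w (q l)) + \sum_(l < 3) f (Fw q w' (q l)) =
  6 * f (Fw q w (q i)) + 2 / 3 * eps * 5 ^- size w.
Proof.
move=> + h; elim: h eps f => {w i w' j} [a b n ab|c w i w' j _ ih] eps f hf; last first.
  have /= := ih _ _ (hext_Fw [:: c] hf).
  by rewrite expr1 exprS invfM !mulrA => ->; rewrite -!mulrA (mulrC 5^-1).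
(* The sum of differences to the junction value is a discrete normal derivative seen from one side:
   each level multiplies it by 3/5 and each of the two new midpoints adds the Laplacian drop. *)
have side c d m : c != d ->
    \sum_(l < 3) f (Fw q (c :: nseq m.+1 d) (q l)) - 3 * f (F q c (q d)) =
    3 / 5 * (\sum_(l < 3) f (Fw q (c :: nseq m d) (q l)) - 3 * f (F q c (q d)))
    - 2 / 15 * eps * 5 ^- m.+1.
  move=> cd; have -> : c :: nseq m.+1 d = rcons (c :: nseq m d) d.
    by rewrite rcons_cons -[in RHS]cats1 -(nseqD m 1) addn1.
  under eq_bigr do rewrite Fw_rcons.
  have e : f (F q c (q d)) = f (Fw q (c :: nseq m d) (q d)) by rewrite /= Fw_nseq.
  have hw l (dl : d != l) := hf (c :: nseq m d) d l dl.
  rewrite e /= size_nseq in hw *; move: hw {e}; rewrite !sum_I3.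
  by move: d cd; apply: I3_case => cd hw; rewrite F_q // !hw //; lra.
elim: n => [|n ihn].
  have hw k l : k != l -> f (F q k (q l)) =
      (f (q o0) + f (q o1) + f (q o2) + f (q k) + f (q l)) / 5 - eps / 5 ^+ 0 / 15.
    by move=> kl; rewrite (hf [::]) //= sum_I3.
  rewrite /= expr1 !sum_I3; move: a ab; apply: I3_case; move: b; apply: I3_case => //= _;
    by rewrite !F_q // !hw // expr0; lra.
have ba : b != a by rewrite eq_sym.
have := side _ _ n ab; have := side _ _ n ba; move: ihn.
rewrite /= !Fw_nseq // (F_q qE b) (F_qC qE b a) !size_nseq !(exprS _ n.+1) invfM => h s1 s2; lra.
Qed.

End Harmonic.

(** * Integration over cells *)

Section Measurability.
Variable R : realType.
Notation pt := (R * R)%type.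

Lemma open_measurable_plane (U : set pt) : open U -> measurable U.
Proof.
move=> oU.
pose box (r : rat * rat * (rat * rat)) : set pt :=
  [set x : R | (ratr r.1.1 < x < ratr r.1.2)%R] `*` [set x : R | (ratr r.2.1 < x < ratr r.2.2)%R].
(* Boxes that leave [U] are replaced by the empty set, so that the union runs over the whole
   countable type of rational quadruples. *)
pose G r : set pt := if pselect (box r `<=` U) then box r else set0.
have -> : U = \bigcup_r G r.
  apply/seteqP; split=> [z Uz|z [r _]]; last first.
    by rewrite /G; case: pselect => // h /h.
  have /nbhs_ballP[e /= e0 he] := open_nbhs_nbhs (conj oU Uz).
  have [a ha] := @rat_in_itvoo R (z.1 - e) z.1 ltac:(lra).
  have [b hb] := @rat_in_itvoo R z.1 (z.1 + e) ltac:(lra).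
  have [c hc] := @rat_in_itvoo R (z.2 - e) z.2 ltac:(lra).
  have [d hd] := @rat_in_itvoo R z.2 (z.2 + e) ltac:(lra).
  rewrite !in_itv /= in ha hb hc hd.
  exists ((a, b), (c, d)) => //; rewrite /G; case: pselect => [h|h].
    by split => /=; lra.
  exfalso; apply: h.
  move=> y [/= h1 h2]; apply: he; split; rewrite /ball /= ltr_norml; lra.
apply: countable_bigcupT_measurable; first exact: countableP.
move=> r; rewrite /G; case: pselect => h; last exact: measurable0.
apply: measurableX.
  have -> : [set x : R | ratr r.1.1 < x < ratr r.1.2] = `](ratr r.1.1), (ratr r.1.2)[%classic.
    by apply/seteqP; split => x; rewrite /= in_itv.
  exact: measurable_itv.
have -> : [set x : R | ratr r.2.1 < x < ratr r.2.2] = `](ratr r.2.1), (ratr r.2.2)[%classic.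
  by apply/seteqP; split => x; rewrite /= in_itv.
exact: measurable_itv.
Qed.

Lemma closed_measurable_plane (A : set pt) : closed A -> measurable A.
Proof. by move=> /closed_openC/open_measurable_plane/measurableC; rewrite setCK. Qed.

Lemma within_continuous_measurable_plane (D : set pt) (f : pt -> R) :
  measurable D -> {within D, continuous f} -> measurable_fun D f.
Proof.
move=> mD /continuousP cf; apply: (measurability _ (RGenOpens.measurableE R)).
move=> _ [_ [a [b ->] <-]].
have oI : open (`]a, b[%classic : set R) by exact: interval_open.
have /open_subspaceP[V oV VD] := cf _ oI.
by rewrite setIC -VD; apply: measurableI => //; exact: open_measurable_plane.
Qed.

End Measurability.

(** * Null overlaps of cells and integrals of rescaled functions *)

Section Integral.
Variable R : realType.
Notation pt := (R * R)%type.
Variable q : 'I_3 -> pt.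
Hypothesis qE : equilateral q.
Variable K : set pt.
Hypothesis KE : is_SG q K.
Variable mu : {measure set pt -> \bar R}.
Hypothesis muT : mu setT = 1%E.
Hypothesis muC : forall w, mu (cell q K w) = (3 ^- size w)%:E.

Lemma cell_measurable w : measurable (cell q K w).
Proof. by apply: closed_measurable_plane; exact: cell_closed. Qed.

Lemma cell_nil : cell q K [::] = K.
Proof. by apply/seteqP; split => [z [y Ky <-] //|z Kz]; exists z. Qed.

Lemma K_measurable : measurable K.
Proof. by rewrite -cell_nil; exact: cell_measurable. Qed.

Lemma set1_measurable_plane (z : pt) : measurable [set z].
Proof.
apply: closed_measurable_plane; apply: compact_closed; last exact: compact_set1.
exact: (@norm_hausdorff _ (R * R)%type).
Qed.

Lemma mu_fin (A : set pt) : measurable A -> mu A \is a fin_num.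
Proof.
move=> mA; rewrite ge0_fin_numE //; apply: (@le_lt_trans _ _ (mu setT)).
  by apply: le_measure; rewrite ?inE.
by rewrite muT ltry.
Qed.

Lemma mu_set1 z : K z -> mu [set z] = 0%E.
Proof.
move=> Kz; have f1 := mu_fin (set1_measurable_plane z).
apply/eqP; rewrite eq_le measure_ge0 andbT -(fineK f1) lee_fin leNgt; apply/negP => p.
have [|n] := @geometric_small R 3^-1 1 (fine (mu [set z])) _ p; first by lra.
apply/negP; rewrite -leNgt mul1r exprVn -lee_fin fineK //.
have [w [a [sw Ka za]]] := K_address KE n Kz.
rewrite -sw -muC; apply: le_measure; rewrite ?inE; first exact: set1_measurable_plane.
  exact: cell_measurable.
by move=> _ ->; rewrite za; exists a.
Qed.

Lemma mu_cellI w w' : size w = size w' -> w != w' -> mu (cell q K w `&` cell q K w') = 0%E.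
Proof.
move=> sw ww; set N := [set Fw q w (q o0)] `|` [set Fw q w (q o1)] `|` [set Fw q w (q o2)].
have m1 i := set1_measurable_plane (Fw q w (q i)).
have N1 i : mu [set Fw q w (q i)] = 0%E.
  by apply: mu_set1; exact: (K_Fw KE _ (K_q qE KE i)).
have mN : measurable N by do 2 (apply: measurableU => //).
apply/eqP; rewrite eq_le measure_ge0 andbT.
apply: (@le_trans _ _ (mu N)).
  apply: le_measure; rewrite ?inE //; first by apply: measurableI; exact: cell_measurable.
  move=> z [[y Ky zy] [y' Ky' zy']].
  have [|i [j [_ yi _]]] := @cell_meet _ _ qE _ KE w w' y y' sw ww Ky Ky'; first by rewrite zy zy'.
  by rewrite -zy yi; move: i {yi}; apply: I3_case; [left; left|left; right|right].
have h : (mu N <= mu [set Fw q w (q o0)] + mu [set Fw q w (q o1)] + mu [set Fw q w (q o2)])%E.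
  apply: le_trans (measureU2 _ _ _) _ => //; first exact: measurableU.
  by apply: leeD => //; exact: measureU2.
by move: h; rewrite !N1 !adde0.
Qed.

Lemma Rintegral_null (N : set pt) (f : pt -> R) :
  measurable N -> measurable_fun N f -> mu N = 0%E -> Rintegral mu N f = 0.
Proof.
move=> mN mf N0; rewrite /Rintegral null_set_integral //.
exact/measurable_EFinP.
Qed.

Lemma Rintegral_setU_null (A B : set pt) (f : pt -> R) : measurable A -> measurable B ->
  mu.-integrable (A `|` B) (EFin \o f) -> mu (A `&` B) = 0%E ->
  Rintegral mu (A `|` B) f = Rintegral mu A f + Rintegral mu B f.
Proof.
move=> mA mB If AB0.
have mAB : measurable (A `|` B) by exact: measurableU.
have mBA : measurable (B `\` A) by exact: measurableD.
have mI : measurable (A `&` B) by exact: measurableI.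
have eAB : A `|` B = A `|` (B `\` A).
  apply/seteqP; split => z; last by case=> [|[]]; [left|right].
  by have [Az|Az] := pselect (A z); [left|case=> // Bz; right].
rewrite {1}eAB Rintegral_setU //; last 2 first.
- by rewrite -eAB.
- by apply/disj_setPS => z [Az [_]].
congr (_ + _); rewrite {2}(_ : B = (A `&` B) `|` (B `\` A)); last first.
  by rewrite setIC setUIDK.
rewrite Rintegral_setU //; last 2 first.
- by apply: integrableS If => //; [exact: measurableU | move=> z [[_ Bz]|[Bz _]]; right].
- by apply/disj_setPS => z [[Az _] [_]].
rewrite (@Rintegral_null (A `&` B)) ?add0r //.
have /measurable_EFinP mf := measurable_int mu If.
have sI : A `&` B `<=` A `|` B by move=> z [Az _]; left.
exact: (measurable_funS mAB sI mf).
Qed.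

(** This class contains the continuous functions and the indicators of truncated cells and is stable
    under sums and products; it settles all integrability conditions, since [mu] is finite. *)
Definition tame (f : pt -> R) : Prop :=
  measurable_fun K f /\ exists M, forall z, K z -> `|f z| <= M.

Lemma tame_continuous f : {within K, continuous f} -> tame f.
Proof.
move=> cf; split; last exact: (compact_abs_bounded KE cf).
by apply: within_continuous_measurable_plane => //; exact: K_measurable.
Qed.

Lemma tame_cst c : tame (cst c).
Proof. by split; [exact: measurable_cst | exists `|c|]. Qed.

Lemma tameD f g : tame f -> tame g -> tame (fun z => f z + g z).
Proof.
move=> [mf [M hM]] [mg [N hN]]; split; first exact: measurable_funD.
by exists (M + N) => z Kz; apply: le_trans (ler_normD _ _) _; apply: lerD; [exact: hM | exact: hN].
Qed.

Lemma tameM f g : tame f -> tame g -> tame (fun z => f z * g z).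
Proof.
move=> [mf [M hM]] [mg [N hN]]; split; first exact: measurable_funM.
exists (M * N) => z Kz; rewrite normrM ler_pM //; [exact: hM | exact: hN].
Qed.

Lemma tameZ c f : tame f -> tame (fun z => c * f z).
Proof. by move=> tf; apply: (tameM (f := cst c)) => //; exact: tame_cst. Qed.

Lemma Finv_measurable i : measurable_fun setT (Finv q i : pt -> pt).
Proof.
apply: measurable_fun_pair; apply: measurable_funB; try exact: measurable_cst;
  apply: measurable_funM; try exact: measurable_cst.
- exact: measurable_fst.
- exact: measurable_snd.
Qed.

Lemma Fwinv_measurable w : measurable_fun setT (Fwinv q w : pt -> pt).
Proof.
elim/last_ind: w => [|w i ih]; first exact: measurable_id.
rewrite (_ : Fwinv q _ = Finv q i \o Fwinv q w); last by apply/funext => z; rewrite Fwinv_rcons.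
exact: (measurableT_comp (Finv_measurable i)).
Qed.

Lemma cell_Fwinv w z : cell q K w z -> K (Fwinv q w z).
Proof. by move=> [y Ky <-]; rewrite FwK. Qed.

Lemma integrable_cell (A : set pt) w f : measurable A -> A `<=` cell q K w -> tame f ->
  mu.-integrable A (EFin \o (f \o Fwinv q w)).
Proof.
move=> mA Aw [mf [M hM]]; apply: measurable_bounded_integrable => //.
- by rewrite -ge0_fin_numE //; exact: mu_fin.
- apply: (measurable_comp K_measurable _ mf).
    by move=> _ [z /Aw/cell_Fwinv Kz <-].
  exact: measurable_funTS (Fwinv_measurable w).
- exists M; split; first exact: num_real.
  move=> N MN z /Aw/cell_Fwinv Kz.
  by apply: le_trans (hM _ Kz) _; exact: ltW.
Qed.

(** The integrand lives on the whole gasket and is read on the cell through [Fwinv], so that one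
    normalized function can be integrated over different cells. *)
Definition cint (w : seq 'I_3) (f : pt -> R) : R :=
  Rintegral mu (cell q K w) (f \o Fwinv q w).

Lemma eq_cint w f g : (forall z, K z -> f z = g z) -> cint w f = cint w g.
Proof.
by move=> fg; apply: eq_Rintegral => z /set_mem/cell_Fwinv Kz /=; exact: fg.
Qed.

Lemma cint_cst w c : cint w (cst c) = c * 3 ^- size w.
Proof.
by rewrite /cint (Rintegral_cst _ (cell_measurable w)) muC.
Qed.

Lemma cintD w f g : tame f -> tame g ->
  cint w (fun z => f z + g z) = cint w f + cint w g.
Proof.
by move=> tf tg; apply: RintegralD; try exact: cell_measurable; exact: integrable_cell (cell_measurable w) _ _.
Qed.

Lemma cintZ w c f : tame f -> cint w (fun z => c * f z) = c * cint w f.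
Proof.
by move=> tf; apply: RintegralZl; [exact: cell_measurable | exact: integrable_cell (cell_measurable w) _ _].
Qed.

Lemma le_cint w f g : tame f -> tame g -> (forall z, K z -> f z <= g z) ->
  cint w f <= cint w g.
Proof.
move=> tf tg fg; apply: le_Rintegral; try exact: cell_measurable;
  try exact: integrable_cell (cell_measurable w) _ _.
by move=> z /cell_Fwinv; exact: fg.
Qed.

Lemma cell_rcons_sub w i : cell q K (rcons w i) `<=` cell q K w.
Proof. by move=> _ [z Kz <-]; rewrite Fw_rcons; exists (F q i z) => //; exact: K_F. Qed.

Lemma cell_split w : cell q K w =
  cell q K (rcons w o0) `|` cell q K (rcons w o1) `|` cell q K (rcons w o2).
Proof.
apply/seteqP; split; last by move=> z [[]|]; exact: cell_rcons_sub.
move=> _ [z Kz <-]; have [i [y [Ky ->]]] := K_split KE Kz; rewrite -Fw_rcons.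
by move: i; apply: I3_case; [left; left|left; right|right]; exists y.
Qed.

Lemma cint_split w f : tame f ->
  cint w f = \sum_(i < 3) cint (rcons w i) (f \o F q i).
Proof.
move=> tf; have e i : cint (rcons w i) (f \o F q i) = Rintegral mu (cell q K (rcons w i)) (f \o Fwinv q w).
  by apply: eq_Rintegral => z _; rewrite /= Fwinv_rcons FinvK.
have m i := cell_measurable (rcons w i).
have nI i j : i != j -> mu (cell q K (rcons w i) `&` cell q K (rcons w j)) = 0%E.
  move=> ij; apply: mu_cellI; first by rewrite !size_rcons.
  by rewrite eqseq_rcons eqxx.
have If A : measurable A -> A `<=` cell q K w -> mu.-integrable A (EFin \o (f \o Fwinv q w)).
  by move=> mA Aw; exact: integrable_cell.
have m01 : measurable (cell q K (rcons w o0) `|` cell q K (rcons w o1)) by exact: measurableU.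
rewrite sum_I3 !e /cint {1}cell_split Rintegral_setU_null //.
- rewrite Rintegral_setU_null //; last exact: nI.
  by apply: If => // z []; exact: cell_rcons_sub.
- by rewrite -cell_split; apply: If => //; exact: cell_measurable.
- rewrite setIUl; apply/eqP; rewrite eq_le measure_ge0 andbT.
  have h : (mu (cell q K (rcons w o0) `&` cell q K (rcons w o2) `|`
                cell q K (rcons w o1) `&` cell q K (rcons w o2)) <=
      mu (cell q K (rcons w o0) `&` cell q K (rcons w o2)) +
      mu (cell q K (rcons w o1) `&` cell q K (rcons w o2)))%E.
    by apply: measureU2; exact: measurableI.
  by move: h; rewrite (nI o0 o2) // (nI o1 o2) // adde0.
Qed.

Lemma tame_hcoord l : tame (hcoord q l).
Proof. by apply: tame_continuous; exact: hcoord_continuous. Qed.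

End Integral.

(** * Energy and the pointwise form of the Laplacian *)

Section Energy.
Variable R : realType.
Notation pt := (R * R)%type.
Variable q : 'I_3 -> pt.

Lemma sum_tuple_cons (V : zmodType) n (f : seq 'I_3 -> V) :
  \sum_(w : n.+1.-tuple 'I_3) f w = \sum_(i < 3) \sum_(w : n.-tuple 'I_3) f (i :: w).
Proof.
rewrite pair_big /=.
rewrite (reindex (fun p : 'I_3 * n.-tuple 'I_3 => [tuple of p.1 :: p.2])) //=.
exists (fun w : n.+1.-tuple 'I_3 => (thead w, [tuple of behead w])) => [[i w] _|w _] /=.
  by congr pair; apply: val_inj.
by rewrite -tuple_eta.
Qed.

Lemma Em2_0 (u f : pt -> R) : Em2 q 0 u f =
  (u (q o0) - u (q o1)) * (f (q o0) - f (q o1)) +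
  (u (q o0) - u (q o2)) * (f (q o0) - f (q o2)) +
  (u (q o1) - u (q o2)) * (f (q o1) - f (q o2)).
Proof.
rewrite /Em2 expr0 mul1r (bigD1 [tuple]) //= [X in _ + X]big1 ?addr0; last first.
  by move=> w /negP[]; apply/eqP; exact: tuple0.
rewrite sum_I3 !(big_mkcond (fun j : 'I_3 => (_ < j)%N)) !sum_I3 /=.
by rewrite !add0r !addr0.
Qed.

Lemma Em2_S m (u f : pt -> R) :
  Em2 q m.+1 u f = 5 / 3 * \sum_(i < 3) Em2 q m (u \o F q i) (f \o F q i).
Proof.
rewrite /Em2 exprS -mulrA; congr (_ * _); rewrite -mulr_sumr; congr (_ * _).
by rewrite (sum_tuple_cons _ (fun w => \sum_(i < 3) \sum_(j < 3 | (i < j)%N)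
  (u (Fw q w (q i)) - u (Fw q w (q j))) * (f (Fw q w (q i)) - f (Fw q w (q j))))).
Qed.

Lemma eq_Em2 m (u f g : pt -> R) : (forall w i, f (Fw q w (q i)) = g (Fw q w (q i))) ->
  Em2 q m u f = Em2 q m u g.
Proof.
move=> fg; congr (_ * _); apply: eq_bigr => w _; apply: eq_bigr => i _; apply: eq_bigr => j _.
by rewrite !fg.
Qed.

Lemma Em2_cst0 m (u : pt -> R) : Em2 q m u (cst 0) = 0.
Proof.
rewrite /Em2 big1 ?mulr0 // => w _; rewrite big1 // => i _; rewrite big1 // => j _.
by rewrite subrr mulr0.
Qed.

Hypothesis qE : equilateral q.

(** Under subdivision the contribution of a midpoint vanishes, because [f] is there the average of
    its neighbors, and the corner contributions shrink by 3/5, which the factor 5/3 cancels. *)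
Lemma Em2_hext m (u f : pt -> R) : hext q 0 f -> Em2 q m u f = Em2 q 0 u f.
Proof.
elim: m u f => // m ih u f hf; rewrite Em2_S.
rewrite (eq_bigr (fun i => Em2 q 0 (u \o F q i) (f \o F q i))); last first.
  by move=> i _; apply: ih; have := hext_Fw [:: i] hf; rewrite mul0r.
have hw k l : k != l -> f (F q k (q l)) =
    (f (q o0) + f (q o1) + f (q o2) + f (q k) + f (q l)) / 5.
  by move=> kl; have := hf [::] k l kl; rewrite /= sum_I3 => ->; lra.
rewrite sum_I3 !Em2_0 /= !F_q // !hw // (F_qC qE o1 o0) (F_qC qE o2 o0) (F_qC qE o2 o1).
by field.
Qed.

Variable K : set pt.
Hypothesis KE : is_SG q K.

(** Continuity is phrased as uniformly small oscillation on the cells of one level because [lift]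
    preserves this form, only shifting the level by one. *)
Definition bubble (f : pt -> R) : Prop :=
  (forall i, f (q i) = 0) /\
  forall e, 0 < e -> exists n, forall w, size w = n ->
    forall a b, K a -> K b -> `|f (Fw q w a) - f (Fw q w b)| <= e.

Definition lift (i : 'I_3) (f : pt -> R) : pt -> R :=
  glueF q (fun k z => if k == i then f z else 0).

Lemma lift_F i f k z : bubble f -> K z -> lift i f (F q k z) = if k == i then f z else 0.
Proof. by move=> [f0 _] Kz; rewrite /lift (glueFE qE KE) // => a b; rewrite !f0 !if_same. Qed.

Lemma bubble_lift i f : bubble f -> bubble (lift i f).
Proof.
move=> bf; have [f0 fo] := bf; split.
  by move=> k; rewrite /lift glueF_q // f0 if_same.
move=> e e0; have [n hn] := fo e e0; exists n.+1 => -[|k w] //= [sw] a b Ka Kb.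
rewrite !lift_F //; try exact: (K_Fw KE).
by case: ifP => _; [exact: hn | rewrite subrr normr0 ltW].
Qed.

Lemma bubble_continuous f : bubble f -> {within K, continuous f}.
Proof. by move=> [_ h]; exact: (within_K_of_osc KE h). Qed.

(* harmonic on the cells of level 1, equal to 1 at [F a (q b) = F b (q a)] and
   to 0 at the other vertices of level 1 *)
Definition tent (a b : 'I_3) : pt -> R :=
  glueF q (fun k z => if k == a then hcoord q b z else if k == b then hcoord q a z else 0).

Lemma tent_compat a b k l : a != b ->
  (if k == a then hcoord q b (q l) else if k == b then hcoord q a (q l) else 0) =
  (if l == a then hcoord q b (q k) else if l == b then hcoord q a (q k) else 0).
Proof.
move=> ab; rewrite !hcoord_q //; move: ab.
by move: a; apply: I3_case; move: b; apply: I3_case; move: k; apply: I3_case; move: l; apply: I3_case.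
Qed.

Lemma tent_F a b k z : a != b -> K z -> tent a b (F q k z) =
  if k == a then hcoord q b z else if k == b then hcoord q a z else 0.
Proof. by move=> ab Kz; rewrite /tent (glueFE qE KE) // => *; exact: tent_compat. Qed.

Lemma bubble_tent a b : a != b -> bubble (tent a b).
Proof.
move=> ab; split.
  move=> k; rewrite /tent glueF_q // !hcoord_q //; move: ab.
  by move: a; apply: I3_case; move: b; apply: I3_case; move: k; apply: I3_case.
move=> e e0; have [|n hn] := @geometric_small R (3 / 5) 2 e _ e0; first by lra.
have ho l w x y : size w = n -> K x -> K y -> `|hcoord q l (Fw q w x) - hcoord q l (Fw q w y)| <= e.
  move=> sw Kx Ky; apply: le_trans (ltW hn); rewrite -sw.
  by apply: le_trans (hcoord_osc qE KE w Kx Ky); rewrite (bigD1 l) //= lerDl sumr_ge0.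
exists n.+1 => -[|k w] //= [sw] x y Kx Ky; rewrite !tent_F //; try exact: (K_Fw KE).
case: ifP => _; first exact: ho.
by case: ifP => _; [exact: ho | rewrite subrr normr0 ltW].
Qed.

(** The tent is transplanted into the cell [w] and extended by zero: a test function that isolates a
    single junction point. *)
Definition tent_in (w : seq 'I_3) (a b : 'I_3) : pt -> R := foldr lift (tent a b) w.

Lemma bubble_tent_in w a b : a != b -> bubble (tent_in w a b).
Proof. by move=> ab; elim: w => [|i w ih] /=; [exact: bubble_tent | exact: bubble_lift]. Qed.

Lemma Em2_lift m u i f : bubble f -> Em2 q m.+1 u (lift i f) = 5 / 3 * Em2 q m (u \o F q i) f.
Proof.
move=> bf; rewrite Em2_S (bigD1 i) //= [X in _ + X]big1 ?addr0.
  congr (_ * _); apply: eq_Em2 => w k /=; rewrite lift_F ?eqxx //.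
  exact: (K_Fw KE _ (K_q qE KE _)).
move=> k ki; rewrite -[RHS](Em2_cst0 m (u \o F q k)); apply: eq_Em2 => w l /=.
by rewrite lift_F ?(negPf ki) //; exact: (K_Fw KE _ (K_q qE KE _)).
Qed.

Lemma Em2_0_hcoord u l : Em2 q 0 u (hcoord q l) = 3 * u (q l) - \sum_(k < 3) u (q k).
Proof. by rewrite Em2_0 !hcoord_q // sum_I3; move: l; apply: I3_case => /=; lra. Qed.

Lemma Em2_tent m u a b : a != b -> Em2 q m.+1 u (tent a b) =
  5 / 3 * (6 * u (F q a (q b)) - \sum_(l < 3) u (F q a (q l)) - \sum_(l < 3) u (F q b (q l))).
Proof.
move=> ab; rewrite Em2_S.
have e k : Em2 q m (u \o F q k) (tent a b \o F q k) =
    if k == a then 3 * u (F q a (q b)) - \sum_(l < 3) u (F q a (q l))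
    else if k == b then 3 * u (F q b (q a)) - \sum_(l < 3) u (F q b (q l)) else 0.
  have ext g : (forall z, K z -> tent a b (F q k z) = g z) ->
      Em2 q m (u \o F q k) (tent a b \o F q k) = Em2 q m (u \o F q k) g.
    by move=> h; apply: eq_Em2 => w l /=; apply: h; exact: (K_Fw KE _ (K_q qE KE _)).
  have [ka|ka] := eqVneq k a.
    rewrite (ext (hcoord q b)); last by move=> z Kz; rewrite tent_F // ka eqxx.
    by rewrite Em2_hext ?Em2_0_hcoord ?ka //; exact: (hext_hcoord qE KE).
  have [kb|kb] := eqVneq k b.
    rewrite (ext (hcoord q a)); last by move=> z Kz; rewrite tent_F // kb eq_sym (negPf ab) eqxx.
    by rewrite Em2_hext ?Em2_0_hcoord ?kb //; exact: (hext_hcoord qE KE).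
  rewrite (ext (cst 0)) ?Em2_cst0 // => z Kz.
  by rewrite tent_F // (negPf ka) (negPf kb).
rewrite sum_I3 !e (F_qC qE b a); congr (_ * _).
by move: a ab {e}; apply: I3_case; move: b; apply: I3_case => //= _; lra.
Qed.

Lemma Em2_tent_in m u w a b : a != b -> Em2 q (size w + m.+1) u (tent_in w a b) =
  (5 / 3) ^+ (size w).+1 * (6 * u (Fw q w (F q a (q b)))
    - \sum_(l < 3) u (Fw q w (F q a (q l))) - \sum_(l < 3) u (Fw q w (F q b (q l)))).
Proof.
move=> ab; elim: w u => [|i w ih] u; first by rewrite add0n expr1 Em2_tent.
by rewrite /= addSn Em2_lift ?ih ?exprS ?mulrA //; exact: bubble_tent_in.
Qed.

Lemma Em2_tent_in_cvg u w a b : a != b ->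
  Em2 q m u (tent_in w a b) @[m --> \oo] -->
  (5 / 3) ^+ (size w).+1 * (6 * u (Fw q w (F q a (q b)))
    - \sum_(l < 3) u (Fw q w (F q a (q l))) - \sum_(l < 3) u (Fw q w (F q b (q l)))).
Proof.
move=> ab; apply: cvg_near_cst; exists (size w).+1 => // m /= hm.
by rewrite -(subnKC hm) addSnnS Em2_tent_in.
Qed.

Lemma domE_tent_in w a b : a != b -> domE q K (tent_in w a b).
Proof.
move=> ab; split; first by apply: bubble_continuous; exact: bubble_tent_in.
by eexists; exact: Em2_tent_in_cvg.
Qed.

(** * Means over cells and the passage from the weak to the pointwise Laplacian *)

Variable mu : {measure set pt -> \bar R}.
Hypothesis muT : mu setT = 1%E.
Hypothesis muC : forall w, mu (cell q K w) = (3 ^- size w)%:E.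

Definition cmean (w : seq 'I_3) (f : pt -> R) : R := 3 ^+ size w * cint q K mu w f.

Lemma eq_cmean w f g : (forall z, K z -> f z = g z) -> cmean w f = cmean w g.
Proof. by move=> fg; rewrite /cmean (eq_cint q mu w fg). Qed.

Lemma cmean_cst w c : cmean w (cst c) = c.
Proof. by rewrite /cmean cint_cst // mulrCA divff ?mulr1 // expf_neq0 // pnatr_eq0. Qed.

Lemma cmeanD w f g : tame K f -> tame K g ->
  cmean w (fun z => f z + g z) = cmean w f + cmean w g.
Proof. by move=> tf tg; rewrite /cmean cintD // mulrDr. Qed.

Lemma cmeanZ w c f : tame K f -> cmean w (fun z => c * f z) = c * cmean w f.
Proof. by move=> tf; rewrite /cmean cintZ // mulrCA. Qed.

Lemma le_cmean w f g : tame K f -> tame K g -> (forall z, K z -> f z <= g z) ->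
  cmean w f <= cmean w g.
Proof. by move=> tf tg fg; rewrite /cmean ler_pM2l ?exprn_gt0 //; exact: le_cint. Qed.

Lemma cmean_split w f : tame K f ->
  cmean w f = 3^-1 * \sum_(i < 3) cmean (rcons w i) (f \o F q i).
Proof.
move=> tf; rewrite /cmean (cint_split qE KE muT muC _ tf).
under [in RHS]eq_bigr do rewrite size_rcons.
by rewrite -mulr_sumr mulrA exprS mulrA mulVf ?mul1r // pnatr_eq0.
Qed.

Lemma cmean_sum w (c : 'I_3 -> R) (f : 'I_3 -> pt -> R) : (forall l, tame K (f l)) ->
  cmean w (fun z => \sum_(l < 3) c l * f l z) = \sum_(l < 3) c l * cmean w (f l).
Proof.
move=> tf; have tz l : tame K (fun z => c l * f l z) by exact: tameZ.
rewrite (@eq_cmean w _ (fun z => c o0 * f o0 z + c o1 * f o1 z + c o2 * f o2 z)); last first.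
  by move=> z _; rewrite sum_I3.
by rewrite cmeanD ?cmeanD ?cmeanZ ?sum_I3 //; exact: tameD.
Qed.

Lemma hstep_lin i (b : 'I_3 -> R) l :
  hstep i b l = \sum_(m < 3) hstep i (fun k => (k == m)%:R) l * b m.
Proof.
rewrite /hstep !sum_I3; move: i; apply: I3_case; move: l; apply: I3_case => /=; lra.
Qed.

Lemma cmean_hstep w i (f : 'I_3 -> pt -> R) l : (forall l, tame K (f l)) ->
  cmean w (fun z => hstep i (f^~ z) l) = hstep i (fun m => cmean w (f m)) l.
Proof.
move=> tf; rewrite [RHS]hstep_lin -cmean_sum //; apply: eq_cmean => z _; exact: hstep_lin.
Qed.

(** The deviations from 1/3 on a cell have sum zero and are the average over the subcells of [hstep]
    applied to their deviations, so [hstep_contract] bounds them by 3/5 of any common bound. *)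
Lemma cmean_hcoord w l : cmean w (hcoord q l) = 3^-1.
Proof.
have th := tame_hcoord qE KE.
pose d w l := cmean w (hcoord q l) - 3^-1.
have sd w' : \sum_(l < 3) d w' l = 0.
  rewrite sumrB (_ : \sum_(l < 3) cmean w' (hcoord q l) = 1); last first.
    rewrite -[RHS](cmean_cst w' 1) -(@eq_cmean w' (fun z => \sum_(l < 3) 1 * hcoord q l z)).
      by rewrite cmean_sum //; apply: eq_bigr => m _; rewrite mul1r.
    by move=> z _; under eq_bigr do rewrite mul1r; rewrite sum_hcoord.
  by rewrite sum_I3; lra.
have ds w' m : d w' m = 3^-1 * \sum_(i < 3) hstep i (d (rcons w' i)) m.
  rewrite {1}/d cmean_split //.
  under eq_bigr => i _.
    rewrite (@eq_cmean _ _ (fun z => hstep i ((fun m z => hcoord q m z)^~ z) m)); last first.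
      by move=> z Kz; exact: (hcoord_F qE KE).
    rewrite cmean_hstep //; over.
  rewrite /d; under [in RHS]eq_bigr do rewrite hstepB.
  rewrite sumrB mulrBr; congr (_ - _); rewrite sum_I3 /hstep !sum_I3.
  by move: m; apply: I3_case => /=; lra.
have h0 : \sum_(m < 3) `|d w m| <= 0.
  apply: (@contraction_le0 R (seq 'I_3) (fun w => \sum_(m < 3) `|d w m|) (3 / 5)); first lra.
    exists 6 => w'; rewrite sum_I3.
    have b m : `|d w' m| <= 2.
      have c0 : 0 <= cmean w' (hcoord q m).
        rewrite -(cmean_cst w' 0); apply: le_cmean => // [|z _]; [exact: tame_cst | exact: hcoord_ge0].
      have c1 : cmean w' (hcoord q m) <= 1.
        rewrite -[leRHS](cmean_cst w' 1); apply: le_cmean => // [|z _]; [exact: tame_cst | exact: hcoord_le1].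
      by rewrite /d ler_norml; lra.
    by have := b o0; have := b o1; have := b o2 => *; lra.
  move=> M M0 hM w'.
  apply: (@le_trans _ _ (3^-1 * \sum_(i < 3) \sum_(m < 3) `|hstep i (d (rcons w' i)) m|)).
    rewrite exchange_big mulr_sumr; apply: ler_sum => m _.
    rewrite ds normrM ger0_norm ?invr_ge0 // ler_pM2l ?invr_gt0 //.
    exact: ler_norm_sum.
  apply: (@le_trans _ _ (3^-1 * \sum_(i < 3) (3 / 5 * M))).
    rewrite ler_pM2l ?invr_gt0 //; apply: ler_sum => i _.
    by apply: le_trans (hstep_contract _ (sd _)) _; rewrite ler_pM2l //; lra.
  by rewrite sum_I3; lra.
have : `|d w l| <= 0 by apply: le_trans h0; rewrite (bigD1 l) //= lerDl sumr_ge0.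
by rewrite normr_le0 /d subr_eq0 => /eqP.
Qed.

Lemma tame_bubble f : bubble f -> tame K f.
Proof. by move=> /bubble_continuous; exact: (tame_continuous KE). Qed.

Lemma cmean_tent w a b : a != b -> cmean w (tent a b) = 2 / 9.
Proof.
move=> ab; rewrite cmean_split; last by apply: tame_bubble; exact: bubble_tent.
have e k : cmean (rcons w k) (tent a b \o F q k) =
    if k == a then 3^-1 else if k == b then 3^-1 else 0.
  rewrite (@eq_cmean _ _ (if k == a then hcoord q b else if k == b then hcoord q a else cst 0)).
    by do 2 (case: ifP => _; first exact: cmean_hcoord); exact: cmean_cst.
  by move=> z Kz /=; rewrite tent_F //; case: ifP => // _; case: ifP.
rewrite sum_I3 !e; move: a ab {e}; apply: I3_case; move: b; apply: I3_case => //= _; lra.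
Qed.

Lemma cint_lift u i f : bubble f -> cint q K mu u (lift i f) = cint q K mu (rcons u i) f.
Proof.
move=> bf; rewrite (cint_split qE KE muT muC); last by apply: tame_bubble; exact: bubble_lift.
rewrite (bigD1 i) //= big1 ?addr0.
  by apply: (eq_cint) => z Kz /=; rewrite lift_F // eqxx.
move=> k ki; rewrite -[RHS](mul0r (3 ^- size (rcons u k))) -(cint_cst KE muC _ 0).
by apply: eq_cint => z Kz /=; rewrite lift_F // (negPf ki).
Qed.

Lemma cint_tent_in u w a b : a != b ->
  cint q K mu u (tent_in w a b) = cint q K mu (u ++ w) (tent a b).
Proof.
move=> ab; elim: w u => [|i w ih] u; first by rewrite cats0.
by rewrite /= cint_lift ?ih ?cat_rcons //; exact: bubble_tent_in.
Qed.

(** The tent in [w] has integral [3 ^- size w * (2 / 9)]; equating its negative with the stationary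
    energy pairing gives one linear equation per midpoint. The constant 2/15 is 2/9 times 3/5. *)
Lemma hext_lap1 v : has_lap q K mu v (fun=> 1) -> hext q 1 v.
Proof.
move=> [_ [_ hv]] w a0 b0 ab0.
have key a b : a != b -> 6 * v (Fw q w (F q a (q b)))
    - \sum_(l < 3) v (Fw q w (F q a (q l))) - \sum_(l < 3) v (Fw q w (F q b (q l))) =
    - (2 / 15 * 5 ^- size w).
  move=> ab; set X := LHS.
  have [bt _] := bubble_tent_in w ab.
  have h1 := hv _ (domE_tent_in w ab) bt.
  have := cvg_unique _ (@Em2_tent_in_cvg v w a b ab) h1 => /(_ (@norm_hausdorff _ _)) /= e.
  have e2 : Rintegral mu K (fun z => 1 * tent_in w a b z) = 3 ^- size w * (2 / 9).
    rewrite -(cmean_tent w ab) /cmean mulrA mulVf ?expf_neq0 ?pnatr_eq0 // mul1r.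
    rewrite -[in RHS](cat0s w) -cint_tent_in // /cint cell_nil.
    by apply: eq_Rintegral => z _ /=; rewrite mul1r.
  move: e; rewrite e2 -/X => e.
  have p3 : (3 : R) ^+ size w != 0 by rewrite expf_neq0 // pnatr_eq0.
  have p5 : (5 : R) ^+ size w != 0 by rewrite expf_neq0 // pnatr_eq0.
  have : (5 / 3 : R) ^+ (size w).+1 * X = (5 / 3) ^+ (size w).+1 * - (2 / 15 * 5 ^- size w).
    by rewrite e exprS expr_div_n; field; rewrite p3 p5.
  by apply: mulfI; rewrite expf_neq0 // mulf_neq0 // ?invr_eq0 pnatr_eq0.
(* The three equations determine the three midpoint values. A common drop [t] below the harmonic
   extension satisfies [- 4 t + 2 t = - 2 / 15 * 5 ^- size w], whence the 1/15 in [hext]. *)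
move: (key o0 o1 isT) (key o0 o2 isT) (key o1 o2 isT).
rewrite !sum_I3 !F_q // (F_qC qE o1 o0) (F_qC qE o2 o0) (F_qC qE o2 o1) mul1r => k1 k2 k3.
move: a0 ab0; apply: I3_case; move: b0; apply: I3_case => //= _;
  rewrite ?(F_qC qE o1 o0) ?(F_qC qE o2 o0) ?(F_qC qE o2 o1); lra.
Qed.

End Energy.

(** * Truncated cells and estimates for the solution *)

Lemma adj_inj w i w' j i' j' : adj w i w' j -> adj w i' w' j' -> i = i'.
Proof.
move=> h; elim: h i' j' => {w i w' j} [a b n ab|c w i w' j h ih] i' j'.
  move e : (a :: nseq n b) => w; move e' : (b :: nseq n a) => w' h.
  case: h e e' => {w i' w' j'} [a' b' n' ab'|c w i w' j h].
    by move=> _ [-> _].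
  by move=> [ac _] [bc _]; rewrite ac bc eqxx in ab.
move e : (c :: w) => x; move e' : (c :: w') => x' h2.
case: h2 e e' => {x i' x' j'} [a' b' n' ab'|c' w2 i2 w2' j2 h2].
  by move=> [ca _] [cb _]; rewrite -ca -cb eqxx in ab'.
by move=> [_ e] [_ e']; apply: (ih _ j2); rewrite e e'.
Qed.

Lemma hstep_perm (R : realType) (p : {perm 'I_3}) i (b : 'I_3 -> R) l :
  hstep (p i) b (p l) = hstep i (b \o p) l.
Proof.
have e : \sum_(m < 3) b (p m) = \sum_(m < 3) b m by rewrite [RHS](reindex_inj (@perm_inj _ p)).
by rewrite /hstep (inj_eq perm_inj) /= e.
Qed.

Lemma hstep_nonexpansive (R : realType) i (d : 'I_3 -> R) :
  \sum_(l < 3) `|hstep i d l| <= \sum_(l < 3) `|d l|.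
Proof.
have bd (t : R) : - `|t| <= t <= `|t| by rewrite -ler_norml.
rewrite /hstep !sum_I3.
have /andP[x1 x2] := bd (d o0); have /andP[y1 y2] := bd (d o1); have /andP[z1 z2] := bd (d o2).
have H (a b c u v w t : R) : - u <= a <= u -> - v <= b <= v -> - w <= c <= w ->
    u + v + w <= t -> `|a| + `|b| + `|c| <= t.
  rewrite -!ler_norml => ha hb hc; apply: le_trans.
  by apply: lerD => //; exact: lerD.
move: x1 x2 y1 y2 z1 z2; move: i; apply: I3_case => /= x1 x2 y1 y2 z1 z2.
- by apply: (H _ _ _ (`|d o0| + 2 * (`|d o1| + `|d o2|) / 5) ((2 * `|d o1| + `|d o2|) / 5)
    ((2 * `|d o2| + `|d o1|) / 5)); try (apply/andP; split); lra.
- by apply: (H _ _ _ ((2 * `|d o0| + `|d o2|) / 5) (`|d o1| + 2 * (`|d o0| + `|d o2|) / 5)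
    ((2 * `|d o2| + `|d o0|) / 5)); try (apply/andP; split); lra.
- by apply: (H _ _ _ ((2 * `|d o0| + `|d o1|) / 5) ((2 * `|d o1| + `|d o0|) / 5)
    (`|d o2| + 2 * (`|d o0| + `|d o1|) / 5)); try (apply/andP; split); lra.
Qed.

Section MeanValue.
Variable R : realType.
Notation pt := (R * R)%type.
Variable q : 'I_3 -> pt.
Hypothesis qE : equilateral q.
Variable K : set pt.
Hypothesis KE : is_SG q K.

(** By [adj_fun] the point lies in no third cell of the level, and by [adj_inj] the two cells share
    no second vertex, so no neighbor is missed or counted twice. *)
Lemma nbrs_adj (h : pt -> R) (m : nat) (w w' : seq 'I_3) i j :
  size w = m -> adj w i w' j ->
  \sum_(y <- nbrs q m (Fw q w (q i))) h y =
  \sum_(l < 3 | l != i) h (Fw q w (q l)) + \sum_(l < 3 | l != j) h (Fw q w' (q l)).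
Proof.
move=> sw a; set x := Fw q w (q i).
have sw' : size w' = m by rewrite -(adj_size a).
have xw' : x = Fw q w' (q j) by exact: adj_Fw.
have Kq := K_q qE KE.
have Fwq_inj u k l : Fw q u (q k) = Fw q u (q l) -> k = l.
  by move=> /(can_inj (FwK q u)) /(q_inj qE KE).
pose s := [seq Fw q w (q l) | l <- enum 'I_3 & l != i] ++
          [seq Fw q w' (q l) | l <- enum 'I_3 & l != j].
have ps : perm_eq (nbrs q m x) s.
  apply: uniq_perm; first exact: undup_uniq.
    have us u k : uniq [seq Fw q u (q l) | l <- enum 'I_3 & l != k].
      rewrite map_inj_uniq; first by apply: filter_uniq; exact: enum_uniq.
      by move=> m1 m2; exact: Fwq_inj.
    rewrite cat_uniq; apply/and3P; split; [exact: us | | exact: us].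
    apply/hasPn => y /mapP[l]; rewrite mem_filter => /andP[lj _] yE.
    rewrite yE {y yE}.
    apply/mapP => -[k]; rewrite mem_filter => /andP[ki _] e.
    have [k' [l' [a' kk _]]] := cell_meet qE KE (adj_size a) (adj_neq a) (Kq k) (Kq l) (esym e).
    by rewrite (q_inj qE KE kk) (adj_inj a' a) eqxx in ki.
  move=> y; rewrite mem_undup mem_cat; apply/mapP/orP.
    move=> [[u l]]; rewrite mem_filter /= => /andP[/andP[/existsP[k /eqP ux] uy] _] ->.
    have [uw|uw] := eqVneq w (u : seq _).
      left; apply/mapP; exists l; last by rewrite uw.
      rewrite mem_filter mem_enum andbT; apply: contraNN uy => /eqP ->.
      by rewrite -uw.
    have [|k' [l' [a' kk _]]] := cell_meet qE KE _ uw (Kq i) (Kq k) (esym ux).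
      by rewrite size_tuple.
    rewrite -(q_inj qE KE kk) in a'; have e := adj_fun a a'.
    right; apply/mapP; exists l; last by rewrite e.
    rewrite mem_filter mem_enum andbT; apply: contraNN uy => /eqP ->.
    by rewrite -e xw'.
  have wit u k l : size u = m -> x = Fw q u (q k) -> l != k ->
      exists2 wj, wj \in [seq wj : m.-tuple 'I_3 * 'I_3 <- enum predT |
          [exists i, Fw q (tval wj.1) (q i) == x] && (Fw q (tval wj.1) (q wj.2) != x)] &
        Fw q u (q l) = Fw q (tval wj.1) (q wj.2).
    move=> su xu lk; exists (tcast su (in_tuple u), l); last by rewrite /= val_tcast.
    rewrite mem_filter mem_enum andbT /= val_tcast /=; apply/andP; split.
      by apply/existsP; exists k; rewrite xu.
    by rewrite xu; apply: contraNN lk => /eqP /Fwq_inj ->.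
  case=> /mapP[l]; rewrite mem_filter mem_enum andbT => lk ->; [exact: (wit w i) | exact: (wit w' j)].
rewrite (perm_big _ ps) big_cat !big_map !big_filter.
by congr (_ + _); rewrite big_enum_cond.
Qed.

Lemma harmonic_hcoord l : Defs.harmonic q K (hcoord q l).
Proof.
split; first exact: hcoord_continuous.
move=> m x _ [w [i ->]] nV; have sw := size_tuple w.
have [e|[w' [j a]]] := adj_exists qE KE w i.
  by exfalso; apply: nV; exists [tuple], i.
rewrite (nbrs_adj _ sw a).
have /= := hext_adj qE (hext_hcoord qE KE l) a.
rewrite (bigD1 i) //= [X in _ + X](bigD1 j) //= -(adj_Fw qE a) mulr0 mul0r addr0 => e.
lra.
Qed.

(** Each [hstep i] is injective: the sum of the vector, then its entry [i], then the others are
    recovered from the image. Hence the harmonic coordinates at the vertices of any cell form an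
    invertible matrix, and testing them determines vertex weights. *)
Lemma hcoord_det (w : seq 'I_3) (g : 'I_3 -> R) :
  (forall m, \sum_(l < 3) g l * hcoord q m (Fw q w (q l)) = 0) -> forall l, g l = 0.
Proof.
have Kq := K_q qE KE.
elim: w => [|i w ih] h l.
  have := h l; rewrite (bigD1 l) //= hcoord_q // eqxx mulr1 big1 ?addr0 // => k kl.
  by rewrite hcoord_q // eq_sym (negPf kl) mulr0.
apply: ih => m; pose b m := \sum_(l < 3) g l * hcoord q m (Fw q w (q l)).
have hb k : hstep i b k = 0.
  rewrite (@hstep_sum _ i g (fun l m => hcoord q m (Fw q w (q l)))) -[RHS](h k).
  by apply: eq_bigr => n _; rewrite /= (hcoord_F qE KE) //; exact: K_Fw.
have b0 : \sum_(k < 3) b k = 0 by rewrite -(sum_hstep i b) big1.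
have bi : b i = 0 by have := hb i; rewrite /hstep eqxx b0 => ?; lra.
rewrite -/(b m); have [->|mi] := eqVneq m i; first exact: bi.
by have := hb m; rewrite /hstep (negPf mi) b0 bi => ?; lra.
Qed.

Variable mu : {measure set pt -> \bar R}.
Hypothesis muT : mu setT = 1%E.
Hypothesis muC : forall w, mu (cell q K w) = (3 ^- size w)%:E.

Local Notation cm := (cmean q K mu).

(** * Means over truncated cells *)

(* The distance of [z] from [q j] along the axis is [1 - bary j z] times the
   height, so this is the indicator of a rescaled [E_i] with [c_i = c]. *)
Definition trunc (j : 'I_3) (c : R) (z : pt) : R := (1 - c <= bary q j z)%R%:R.

Lemma tame_trunc j c : tame K (trunc j c).
Proof.
pose A := [set z : pt | 1 - c <= bary q j z].
have cA : closed A.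
  apply: (@preimage_closed _ _ (bary q j) [set x : R | 1 - c <= x]); last exact: closed_ge.
  by move=> z _; exact: bary_continuous.
have -> : trunc j c = \1_A.
  by apply/funext => z; rewrite indicE /trunc; congr (_%:R); congr nat_of_bool; apply/idP/idP; rewrite inE.
split; first by apply: measurable_indic; exact: closed_measurable_plane.
by exists 1 => z _; rewrite indicE; case: (_ \in _); rewrite ?normr0 ?normr1.
Qed.

Lemma trunc_ge0 j c z : 0 <= trunc j c z. Proof. exact: ler0n. Qed.

Lemma trunc_le1 j c z : trunc j c z <= 1.
Proof. by rewrite /trunc lern1 leq_b1. Qed.

Lemma trunc_F j c i z : trunc j c (F q i z) = trunc j (2 * c - 1 + (i == j)%:R) z.
Proof.
rewrite /trunc bary_F //; congr (nat_of_bool _)%:R.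
by apply/idP/idP => ?; lra.
Qed.

Lemma trunc_lt0 j c z : c < 0 -> K z -> trunc j c z = 0.
Proof.
by move=> c0 Kz; have b1 := bary_le1 qE KE j Kz; rewrite /trunc; case: leP => // h; exfalso; lra.
Qed.

Lemma trunc_ge1 j c z : 1 <= c -> K z -> trunc j c z = 1.
Proof.
by move=> c0 Kz; have b0 := bary_ge0 qE KE j Kz; rewrite /trunc; case: leP => // h; exfalso; lra.
Qed.

Definition htrunc (l j : 'I_3) (c : R) (z : pt) : R := hcoord q l z * trunc j c z.

Lemma tame_htrunc l j c : tame K (htrunc l j c).
Proof. by apply: tameM; [exact: tame_hcoord | exact: tame_trunc]. Qed.

Lemma cmean_htrunc_ge0 w l j c : 0 <= cm w (htrunc l j c).
Proof.
rewrite -(cmean_cst KE muC w 0); apply: le_cmean => //.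
- exact: tame_cst.
- exact: tame_htrunc.
- by move=> z _; rewrite mulr_ge0 ?trunc_ge0 ?hcoord_ge0.
Qed.

Lemma cmean_htrunc_le w l j c : cm w (htrunc l j c) <= 3^-1.
Proof.
rewrite -(cmean_hcoord qE KE muT muC w l); apply: le_cmean => //.
- exact: tame_htrunc.
- exact: tame_hcoord.
- by move=> z _; rewrite /htrunc ler_piMr ?trunc_le1 ?hcoord_ge0.
Qed.

Lemma cmean_htrunc_split w l j c : cm w (htrunc l j c) =
  3^-1 * \sum_(i < 3) hstep i (fun m => cm (rcons w i) (htrunc m j (2 * c - 1 + (i == j)%:R))) l.
Proof.
rewrite (cmean_split qE KE muT muC _ (tame_htrunc l j c)); congr (_ * _); apply: eq_bigr => i _.
rewrite -(cmean_hstep KE muT); last by move=> m; exact: tame_htrunc.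
apply: eq_cmean => z Kz; rewrite /= /htrunc trunc_F (hcoord_F qE KE) //.
by rewrite /hstep !sum_I3; case: ifP => _; lra.
Qed.

(* The reflection of the triangle that fixes [q j] exchanges [hcoord l] and
   [hcoord l']; self-similarity turns this symmetry into a contraction. *)
Lemma cmean_htrunc_sym w l l' j c : l != j -> l' != j ->
  cm w (htrunc l j c) = cm w (htrunc l' j c).
Proof.
move=> lj l'j; pose p := tperm l l'.
have pj : p j = j by rewrite tpermD.
(* The reflection sends the subcell [i] to [p i], so the recursion leaves the diagonal: the defect
   must compare two different words. *)
pose d (t : seq 'I_3 * seq 'I_3 * R) m := cm t.1.1 (htrunc m j t.2) - cm t.1.2 (htrunc (p m) j t.2).
pose step c i : R := 2 * c - 1 + (i == j)%:R.
have stepp c' i : step c' (p i) = step c' i.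
  by rewrite /step; have -> : (p i == j) = (i == j) by rewrite -{1}pj (inj_eq perm_inj).
have ds u u' c' m : d (u, u', c') m =
    3^-1 * \sum_(i < 3) hstep i (d (rcons u i, rcons u' (p i), step c' i)) m.
  rewrite /d /= [X in X - _]cmean_htrunc_split [X in _ - X]cmean_htrunc_split -mulrBr.
  congr (_ * _); rewrite [X in _ - X](reindex_inj (@perm_inj _ p)) -sumrB /=.
  apply: eq_bigr => i _; rewrite hstep_perm -hstepB.
  by rewrite -/(step c' (p i)) stepp.
have d_lt0 u u' c' m : c' < 0 -> d (u, u', c') m = 0.
  have z t k : c' < 0 -> cm t (htrunc k j c') = 0.
    move=> c0; rewrite -(cmean_cst KE muC t 0); apply: eq_cmean => z Kz.
    by rewrite /htrunc trunc_lt0 // mulr0.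
  by move=> c0; rewrite /d /= !z // subrr.
have d_ge1 u u' c' m : 1 <= c' -> d (u, u', c') m = 0.
  have z t k : 1 <= c' -> cm t (htrunc k j c') = 3^-1.
    move=> c1; rewrite -(cmean_hcoord qE KE muT muC t k); apply: eq_cmean => z Kz.
    by rewrite /htrunc trunc_ge1 // mulr1.
  by move=> c1; rewrite /d /= !z // subrr.
have h0 t : \sum_(m < 3) `|d t m| <= 0.
  move: t; apply: (@contraction_le0 R _ (fun t => \sum_(m < 3) `|d t m|) (2 / 3)); first lra.
    exists 3 => t; have b m : `|d t m| <= 1.
      rewrite ler_norml /d; have := cmean_htrunc_ge0 t.1.1 m j t.2.
      have := cmean_htrunc_le t.1.1 m j t.2; have := cmean_htrunc_ge0 t.1.2 (p m) j t.2.
      by have := cmean_htrunc_le t.1.2 (p m) j t.2 => *; apply/andP; split; lra.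
    by rewrite sum_I3; have := b o0; have := b o1; have := b o2 => *; lra.
  move=> M M0 hM [[u u'] c'].
  pose g i := \sum_(m < 3) `|d (rcons u i, rcons u' (p i), step c' i) m|.
  have le1 : \sum_(m < 3) `|d (u, u', c') m| <= 3^-1 * \sum_(i < 3) g i.
    apply: (@le_trans _ _ (3^-1 * \sum_(i < 3) \sum_(m < 3)
        `|hstep i (d (rcons u i, rcons u' (p i), step c' i)) m|)).
      rewrite exchange_big mulr_sumr; apply: ler_sum => m _.
      rewrite ds normrM ger0_norm ?invr_ge0 // ler_pM2l ?invr_gt0 //.
      exact: ler_norm_sum.
    by rewrite ler_pM2l ?invr_gt0 //; apply: ler_sum => i _; exact: hstep_nonexpansive.
  apply: le_trans le1 _.
  have gM i : g i <= M by exact: hM.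
  suff : \sum_(i < 3) g i <= 2 * M by move=> ?; lra.
  (* Below 1/2 the truncation meets the subcell at [q j] only; from 1/2 on it contains that subcell
     entirely and the defect there is zero. So at most two of the three subcells count, which gives
     the factor 2/3. *)
  have [c0|c0] := ltP c' 2^-1.
    rewrite (bigD1 j) //= big1 ?addr0; first by apply: le_trans (gM j) _; lra.
    move=> i ij; rewrite /g big1 // => m _; rewrite d_lt0 ?normr0 //.
    by rewrite /step (negPf ij) /=; lra.
  rewrite (bigD1 j) //= [g j]big1 ?add0r; last first.
    by move=> m _; rewrite d_ge1 ?normr0 // /step eqxx /=; lra.
  rewrite (big_mkcond (fun i => i != j)) sum_I3 /=.
  have := gM o0; have := gM o1; have := gM o2.
  by move: (j); apply: I3_case => /= *; lra.
have : `|d (w, w, c) l| <= 0 by apply: le_trans (h0 (w, w, c)); rewrite (bigD1 l) //= lerDl sumr_ge0.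
by rewrite normr_le0 /d /= /p tpermL subr_eq0 => /eqP.
Qed.

(** * Bounds for the solution with Laplacian 1 and zero boundary values *)

Variable v : pt -> R.
Hypothesis cv : {within K, continuous v}.
Hypothesis hv : hext q 1 v.
Hypothesis v0 : forall i, v (q i) = 0.

Lemma lap1_F i y : K y -> v (F q i y) = v y / 5 - (1 - hcoord q i y) / 15.
Proof.
move=> Ky; have /= -> := hext_Fw_eq qE KE [:: i] cv hv v0 cv hv Ky.
have vm k : k != i -> v (F q i (q k)) = - 15^-1.
  by move=> ki; have /= -> := hv [::] (_ : i != k); rewrite 1?eq_sym // big1 // !v0; lra.
rewrite (bigD1 i) //= F_q // v0 mul0r add0r.
rewrite (eq_bigr (fun k => - 15^-1 * hcoord q k y)); last by move=> k ki; rewrite vm.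
rewrite -mulr_sumr; have := sum_hcoord q y; rewrite (bigD1 i) //= => e.
by rewrite expr1; lra.
Qed.

(** The bound is the fixed point of [t / 5 - 1 / 15], the worst case of [lap1_F]. *)
Lemma lap1_ge y : K y -> - 12^-1 <= v y.
Proof.
move=> Ky; rewrite -subr_le0; move: y Ky.
apply: (K_contraction KE (r := 5^-1)); first lra.
  by move=> z; apply: cvgB; [exact: cvg_cst | exact: cv].
move=> M M0 hM z /(K_split KE)[i [y [Ky ->]]]; rewrite lap1_F //.
by have := hM y Ky; have := hcoord_ge0 q i y => *; lra.
Qed.

(* The comparison function has vanishing normal derivative at [q j]. *)
Lemma lap1_ge_vertex j y : K y -> - ((1 - hcoord q j y) / 6) <= v y.
Proof.
move=> Ky; rewrite -subr_le0; move: y Ky.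
apply: (K_contraction KE (r := 5^-1)); first lra.
  move=> z; apply: cvgB; last exact: cv.
  apply: cvgN; apply: cvgMl; apply: cvgB; [exact: cvg_cst | exact: (hcoord_continuous qE KE)].
move=> M M0 hM z /(K_split KE)[i [y [Ky ->]]]; rewrite lap1_F // (hcoord_F qE KE) // /hstep.
rewrite sum_hcoord //; have := hM y Ky; have := lap1_ge Ky.
have [->|ji] := eqVneq j i; first by move=> *; lra.
(* In a subcell away from [q j] the comparison function is at most -1/10, and the crude bound -1/12
   suffices. *)
have := hcoord_ge0 q i y; have := hcoord_le1 q j y => *; lra.
Qed.

(** On the subcell [i], let [s] be [1 - h_i] and [b], [c] the other two coordinates. Passing to the
    subcell shrinks the defect by 5, and the inequality multiplied by 12 keeps the margin
    [(4 s^2 + 8 b c) / 25], which is nonnegative. *)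
Lemma lap1_le y : K y -> v y <= - ((1 - \sum_(l < 3) hcoord q l y ^+ 2) / 12).
Proof.
have hS : {within K, continuous (fun y => \sum_(l < 3) hcoord q l y ^+ 2)}.
  have -> : (fun y => \sum_(l < 3) hcoord q l y ^+ 2) = (fun y =>
      hcoord q o0 y * hcoord q o0 y + hcoord q o1 y * hcoord q o1 y + hcoord q o2 y * hcoord q o2 y).
    by apply/funext => z; rewrite sum_I3 !expr2.
  have hc l := @hcoord_continuous _ _ qE _ KE l.
  by move=> z; apply: cvgD; [apply: cvgD|]; apply: cvgM; exact: hc.
move=> Ky; rewrite -subr_le0; move: y Ky.
apply: (K_contraction KE (r := 5^-1)); first lra.
  move=> z; apply: cvgB; first exact: cv.
  apply: cvgN; apply: cvgMl; apply: cvgB; [exact: cvg_cst | exact: (hS z)].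
move=> M M0 hM z /(K_split KE)[i [y [Ky ->]]]; rewrite lap1_F //.
have := hM y Ky; have := sum_hcoord q y.
have := hcoord_ge0 q o0 y; have := hcoord_ge0 q o1 y; have := hcoord_ge0 q o2 y.
rewrite !sum_I3 !(hcoord_F qE KE) // /hstep !sum_I3.
move: i; apply: I3_case => /=; move: (hcoord q o0 y) (hcoord q o1 y) (hcoord q o2 y) (v y)
  => a b c t c0 b0 a0 s h;
  (have ec : c = 1 - a - b by lra); subst c;
  have ab := mulr_ge0 a0 b0; have ac := mulr_ge0 a0 c0; have bc := mulr_ge0 b0 c0;
  have s1 := sqr_ge0 (1 - a); have s2 := sqr_ge0 (1 - b); have s3 := sqr_ge0 (a + b); lra.
Qed.

Lemma lap1_le0 y : K y -> v y <= 0.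
Proof.
move=> Ky; apply: le_trans (lap1_le Ky) _; have := sum_hcoord q y.
have := hcoord_ge0 q o0 y; have := hcoord_ge0 q o1 y; have := hcoord_ge0 q o2 y.
have := hcoord_le1 q o0 y; have := hcoord_le1 q o1 y; have := hcoord_le1 q o2 y.
by rewrite !sum_I3 => *; nra.
Qed.

Lemma tame_lap1 : tame K v. Proof. exact: (tame_continuous KE cv). Qed.

(** Averaging [lap1_F] over the three subcells gives the recursion [t / 5 - 2 / 45], with fixed
    point -1/18. *)
Lemma cmean_lap1_ge w : - 18^-1 <= cm w v.
Proof.
have tv := tame_lap1; have th := tame_hcoord qE KE.
rewrite -subr_le0; move: w.
apply: (@contraction_le0 R _ (fun w => - 18^-1 - cm w v) 5^-1); first lra.
  exists 1 => w; suff : - 12^-1 <= cm w v by move=> *; lra.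
  by rewrite -(cmean_cst KE muC w (- 12^-1)); apply: le_cmean => // [|z]; [exact: tame_cst | exact: lap1_ge].
move=> M M0 hM w; rewrite (cmean_split qE KE muT muC _ tv).
have e i : cm (rcons w i) (v \o F q i) = 5^-1 * cm (rcons w i) v + (- 15^-1 + 15^-1 * 3^-1).
  rewrite (@eq_cmean _ _ _ _ _ _ (fun z => 5^-1 * v z + (cst (- 15^-1) z + 15^-1 * hcoord q i z))).
    have tc := @tame_cst R K (- 15^-1); have tz := tameZ (15^-1) (th i).
    rewrite (cmeanD KE muT); [|exact: tameZ|exact: tameD].
    rewrite (cmeanD KE muT) // !(cmeanZ KE muT) // (cmean_cst KE muC).
    by rewrite (cmean_hcoord qE KE muT muC).
  by move=> z Kz /=; rewrite lap1_F //; lra.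
rewrite sum_I3 !e; have := hM (rcons w o0); have := hM (rcons w o1); have := hM (rcons w o2).
by move=> *; lra.
Qed.

End MeanValue.

(** * Mean value neighborhoods *)

(** With [g i = s h_i], the right-hand side is [12 s^2] times the lower bound obtained for the
    normalized [c_B] from the mean bound -1/18, the vertex bound and the quadratic bound for [v]. *)
Lemma mean_value_gap (R : realFieldType) (A D : 'I_3 -> R) (g : 'I_3 -> R) (s T : R) :
  (forall i, 0 <= A i) -> (forall i, 0 <= D i <= 3^-1) ->
  T = \sum_(i < 3) D i -> s = \sum_(i < 3) g i ->
  (forall i, g i = 3^-1 + A i + 5 * D i - T) ->
  2 / 3 * \sum_(i < 3) (A i + 2 * D i) <=
  s ^+ 2 + s * (4 * T - 2 / 3) - \sum_(i < 3) g i ^+ 2.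
Proof.
move=> hA hD; rewrite !sum_I3 => -> -> ha; rewrite !ha.
have a0 := hA o0; have a1 := hA o1; have a2 := hA o2.
have /andP[d0 e0] := hD o0; have /andP[d1 e1] := hD o1; have /andP[d2 e2] := hD o2.
move: (A o0) (A o1) (A o2) (D o0) (D o1) (D o2) a0 a1 a2 d0 e0 d1 e1 d2 e2 {hA hD ha}.
move=> a b c x y z a0 b0 c0 x0 x1 y0 y1 z0 z1.
(* the difference of the two sides is a combination of the following products *)
have px : 0 <= x * (3^-1 - x) by rewrite mulr_ge0 // subr_ge0.
have py : 0 <= y * (3^-1 - y) by rewrite mulr_ge0 // subr_ge0.
have pz : 0 <= z * (3^-1 - z) by rewrite mulr_ge0 // subr_ge0.
have ab := mulr_ge0 a0 b0; have ac := mulr_ge0 a0 c0; have bc := mulr_ge0 b0 c0.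
have xy := mulr_ge0 x0 y0; have xz := mulr_ge0 x0 z0; have yz := mulr_ge0 y0 z0.
have ay := mulr_ge0 a0 y0; have az := mulr_ge0 a0 z0; have bx := mulr_ge0 b0 x0.
have bz := mulr_ge0 b0 z0; have cx := mulr_ge0 c0 x0; have cy := mulr_ge0 c0 y0.
lra.
Qed.

Section Neighborhood.
Variable R : realType.
Notation pt := (R * R)%type.
Variable q : 'I_3 -> pt.
Hypothesis qE : equilateral q.
Variable K : set pt.
Hypothesis KE : is_SG q K.
Variable mu : {measure set pt -> \bar R}.
Hypothesis muT : mu setT = 1%E.
Hypothesis muC : forall w, mu (cell q K w) = (3 ^- size w)%:E.

Local Notation cm := (cmean q K mu).

Lemma centroid_nil : centroid q [::] = barycenter q.
Proof. by rewrite /centroid /barycenter /= inord_o1 inord_o2 (_ : ord0 = o0) //; exact: val_inj. Qed.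

Lemma centroid_Fw w : centroid q w = Fw q w (barycenter q).
Proof.
elim: w => [|i w ih]; first exact: centroid_nil.
by rewrite /= -ih /centroid /F /=; congr pair; field.
Qed.

Lemma inner_center j : inner (psub (barycenter q) (q j)) (psub (barycenter q) (q j)) = side2 q / 3.
Proof.
have [h1 h2 h3] := sides qE; rewrite /inner /barycenter /psub /= in h1 h2 h3 *.
by move: j; apply: I3_case => /=; lra.
Qed.

Lemma edist_Fw w a b : Defs.edist (Fw q w a) (Fw q w b) = 2 ^- size w * Defs.edist a b.
Proof.
rewrite /Defs.edist psub_Fw; set k := 2 ^- size w.
rewrite (_ : inner _ _ = k ^+ 2 * inner (psub a b) (psub a b)); last by rewrite /inner /=; ring.
by rewrite sqrtrM ?sqr_ge0 // sqrtr_sqr ger0_norm // invr_ge0 exprn_ge0.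
Qed.

Lemma Eset_trunc w w' j c y : size w' = size w ->
  (inner (psub (Fw q w' y) (Fw q w' (q j))) (axis_unit q w' (Fw q w' (q j))) <= c * height q w)
  = (1 - c <= bary q j y).
Proof.
move=> sw; rewrite /axis_unit /height centroid_Fw !edist_Fw !psub_Fw sw.
rewrite inord_o1 (_ : ord0 = o0); last exact: val_inj.
rewrite /Defs.edist inner_center -/(side2 q) /bary.
set g := psub (barycenter q) (q j); set z := psub y (q j).
have L0 := side2_gt0 qE; set L := side2 q in L0 *.
have k0 : 0 < 2 ^- size w :> R by rewrite invr_gt0 exprn_gt0.
set k := 2 ^- size w in k0 *.
set r := Num.sqrt (L / 3).
have r0 : 0 < r by rewrite sqrtr_gt0 divr_gt0.
(* Side times the square root of 3 is twice the height, and [r] is the distance from the center to a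
   vertex; this removes the roots from the comparison. *)
have rL : Num.sqrt L * Num.sqrt 3 = L / r.
  apply: (mulIf (lt0r_neq0 r0)); rewrite divfK ?lt0r_neq0 // -!sqrtrM ?mulr_ge0 ?ltW //.
  by rewrite (_ : L * 3 * (L / 3) = L ^+ 2) ?sqrtr_sqr ?gtr0_norm //; field.
rewrite /inner /=.
have -> : k * z.1 * (k * g.1 / (k * r)) + k * z.2 * (k * g.2 / (k * r)) =
    k / r * (z.1 * g.1 + z.2 * g.2).
  by field; rewrite !lt0r_neq0.
have -> : c * (k * Num.sqrt L * Num.sqrt 3 / 2) = k / r * (c * L / 2).
  by rewrite -(mulrA k) rL; field; rewrite lt0r_neq0.
rewrite ler_pM2l ?divr_gt0 //; set t := z.1 * g.1 + z.2 * g.2.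
rewrite -(ler_pM2l (_ : 0 < 2 / L)) ?divr_gt0 // (_ : 2 / L * (c * L / 2) = c); last first.
  by field; rewrite lt0r_neq0.
by apply/idP/idP => h; lra.
Qed.

Lemma Eset_measurable w w' i j c : size w' = size w -> Fw q w (q i) = Fw q w' (q j) ->
  measurable (Eset q K w w' (Fw q w (q i)) c).
Proof.
move=> sw e.
have -> : Eset q K w w' (Fw q w (q i)) c =
    cell q K w' `&` Fwinv q w' @^-1` [set z | 1 - c <= bary q j z].
  apply/seteqP; split => z [[y Ky <-]] /=; rewrite /Eset /= e FwK Eset_trunc //.
    by move=> h; split => //; exists y.
  by move=> h; split => //; exists y.
apply: measurableI; first exact: (cell_measurable KE).
rewrite -[X in measurable X]setTI; apply: Fwinv_measurable => //.
apply: closed_measurable_plane.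
apply: (@preimage_closed _ _ (bary q j) [set x : R | 1 - c <= x]); last exact: closed_ge.
by move=> z _; exact: bary_continuous.
Qed.

Lemma Rintegral_Eset w w' i j c f : size w' = size w -> Fw q w (q i) = Fw q w' (q j) ->
  Rintegral mu (Eset q K w w' (Fw q w (q i)) c) f =
  3 ^- size w * cm w' (fun z => f (Fw q w' z) * trunc q j c z).
Proof.
move=> sw e; rewrite /cmean sw mulrA mulVf ?expf_neq0 ?pnatr_eq0 // mul1r.
have -> : Eset q K w w' (Fw q w (q i)) c = cell q K w' `&`
  [set z | inner (psub z (Fw q w (q i))) (axis_unit q w' (Fw q w (q i))) <= c * height q w] by [].
rewrite Rintegral_mkcondr; apply: eq_Rintegral => z /set_mem[y Ky <-] /=.
rewrite patchE FwK /trunc -(@Eset_trunc w w' j c y) // -e.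
case: ifPn => [/set_mem /= ->|/negP h]; first by rewrite mulr1.
rewrite (_ : (_ <= _) = false) ?mulr0 //; apply/negbTE/negP => h'.
by apply: h; exact/mem_set.
Qed.

Lemma cmean_eq_Rintegral w f :
  Rintegral mu (cell q K w) f = 3 ^- size w * cm w (f \o Fw q w).
Proof.
rewrite /cmean mulrA mulVf ?expf_neq0 ?pnatr_eq0 // mul1r.
by apply: eq_Rintegral => z /set_mem[y Ky <-] /=; rewrite FwK.
Qed.

Lemma Rintegral_Bset w (w' : 'I_3 -> seq 'I_3) (j : 'I_3 -> 'I_3) c f :
  (forall i, adj w i (w' i) (j i)) -> {within K, continuous f} ->
  Rintegral mu (Bset q K w w' c) f = 3 ^- size w *
    (cm w (f \o Fw q w) +
     \sum_(i < 3) cm (w' i) (fun z => f (Fw q (w' i) z) * trunc q (j i) (c i) z)).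
Proof.
move=> a cf; pose E i := Eset q K w (w' i) (Fw q w (q i)) (c i).
have sw i : size (w' i) = size w by rewrite (adj_size (a i)).
have mE i : measurable (E i) by apply: (@Eset_measurable _ _ _ (j i)) => //; exact: adj_Fw.
have mw := cell_measurable KE w.
have Ew i : E i `<=` cell q K (w' i) by move=> z [].
have BK : Bset q K w w' c = cell q K w `|` E o0 `|` E o1 `|` E o2.
  apply/seteqP; split => [z [zw|[i _ zi]]|z].
  - by do 3 left.
  - by move: i zi; apply: I3_case => zi; [left; left; right | left; right | right].
  - by case=> [[[zw|zi]|zi]|zi]; [left|right; exists o0|right; exists o1|right; exists o2].
have cK u : cell q K u `<=` K by move=> _ [y Ky <-]; exact: K_Fw.
have If A : measurable A -> A `<=` K -> mu.-integrable A (EFin \o f).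
  move=> mA AK; have := @integrable_cell _ _ _ KE mu muT A [::] f mA.
  by rewrite cell_nil; apply => //; exact: (tame_continuous KE cf).
(* Two cells share at most one vertex, so the neighbors at different corners are distinct cells and
   their overlaps are null. *)
have ij_neq i k : i != k -> w' i != w' k.
  move=> ik; apply/eqP => e; have ai := a i; rewrite e in ai.
  by move: ik; rewrite (adj_inj ai (a k)) eqxx.
have nE i k : i != k -> mu (E i `&` E k) = 0%E.
  move=> ik; apply: (@subset_measure0 _ _ _ _ _ (cell q K (w' i) `&` cell q K (w' k))).
  - exact: measurableI.
  - by apply: measurableI; exact: (cell_measurable KE).
  - by move=> z [/Ew ? /Ew ?].
  - by apply: (mu_cellI qE KE muT muC); [rewrite !sw | exact: ij_neq].
have nw k : mu (cell q K w `&` E k) = 0%E.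
  apply: (@subset_measure0 _ _ _ _ _ (cell q K w `&` cell q K (w' k))).
  - exact: measurableI.
  - by apply: measurableI; exact: (cell_measurable KE).
  - by move=> z [? /Ew ?].
  - by apply: (mu_cellI qE KE muT muC); [rewrite sw | exact: (adj_neq (a k))].
have nU (A B C : set pt) : measurable A -> measurable B -> measurable C ->
    mu (A `&` C) = 0%E -> mu (B `&` C) = 0%E -> mu ((A `|` B) `&` C) = 0%E.
  move=> mA mB mC A0 B0; rewrite setIUl; apply/eqP; rewrite eq_le measure_ge0 andbT.
  have h : (mu (A `&` C `|` B `&` C) <= mu (A `&` C) + mu (B `&` C))%E.
    by apply: measureU2; exact: measurableI.
  by move: h; rewrite A0 B0 adde0.
have EK i : E i `<=` K by move=> z /Ew/cK.
have m1 : measurable (cell q K w `|` E o0) by exact: measurableU.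
have m2 : measurable (cell q K w `|` E o0 `|` E o1) by exact: measurableU.
rewrite BK !Rintegral_setU_null //; first last.
- by apply: (nU _ _ _) => //; [apply: (nU _ _ _) => //|]; exact: nE.
- apply: If; first exact: measurableU.
  by move=> z [[[/cK|/EK]|/EK]|/EK].
- by apply: (nU _ _ _) => //; exact: nE.
- by apply: If => // z [[/cK|/EK]|/EK].
- by apply: If => // z [/cK|/EK].
rewrite cmean_eq_Rintegral sum_I3 !mulrDr !addrA.
by rewrite /E !(Rintegral_Eset _ _ (sw _) (adj_Fw qE (a _))).
Qed.

End Neighborhood.

(** * Quadrature over a neighborhood and the final constants *)

Section Quadrature.
Variable R : realType.
Notation pt := (R * R)%type.
Variable q : 'I_3 -> pt.
Hypothesis qE : equilateral q.
Variable K : set pt.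
Hypothesis KE : is_SG q K.
Variable mu : {measure set pt -> \bar R}.
Hypothesis muT : mu setT = 1%E.
Hypothesis muC : forall w, mu (cell q K w) = (3 ^- size w)%:E.
Variable v : pt -> R.
Hypothesis cv : {within K, continuous v}.
Hypothesis hv : hext q 1 v.
Hypothesis v0 : forall i, v (q i) = 0.

Local Notation cm := (cmean q K mu).

(* Only the sum of the values at the two far vertices of a neighboring cell
   enters, and the junction relation [hext_adj] expresses it through the cell [w]. *)
Lemma Bset_quadrature w (w' : 'I_3 -> seq 'I_3) (j : 'I_3 -> 'I_3) c :
  (forall i, adj w i (w' i) (j i)) ->
  exists (A D : 'I_3 -> R) (J : R), [/\ forall i, 0 <= A i <= 3^-1, forall i, 0 <= D i <= 3^-1,
    3^-1 * \sum_(i < 3) D i - 18^-1 <= J, J <= 2 / 3 * \sum_(i < 3) D i &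
    forall eps f, {within K, continuous f} -> hext q eps f ->
      Rintegral mu (Bset q K w w' c) f = 3 ^- size w *
        (\sum_(l < 3) (3^-1 + A l + 5 * D l - \sum_(i < 3) D i) * f (Fw q w (q l))
         + eps * 5 ^- size w * J)].
Proof.
(* Any vertex other than [j i] would do: by [cmean_htrunc_sym] both far vertices give the same
   [D i]. *)
move=> a; pose o i := if j i == o0 then o1 else o0.
have oj i : o i != j i by rewrite /o; move: (j i); apply: I3_case.
pose A i := cm (w' i) (htrunc q (j i) (j i) (c i)).
pose D i := cm (w' i) (htrunc q (o i) (j i) (c i)).
pose vt i z := v z * trunc q (j i) (c i) z.
have tv := tame_lap1 KE cv; have th := tame_hcoord qE KE.
have tt i : tame K (trunc q (j i) (c i)) by exact: tame_trunc.
have tht l i := tame_htrunc qE KE l (j i) (c i).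
have tvt i : tame K (vt i) by exact: tameM.
have YD i l : l != j i -> cm (w' i) (htrunc q l (j i) (c i)) = D i.
  by move=> lj; exact: (cmean_htrunc_sym qE KE muT muC).
have sumY i (g : 'I_3 -> R) : \sum_(l < 3) g l * cm (w' i) (htrunc q l (j i) (c i)) =
    A i * g (j i) + D i * (\sum_(l < 3) g l - g (j i)).
  rewrite (bigD1 (j i)) //= [X in D i * (X - _)](bigD1 (j i)) //= (addrC (g _) _) addrK mulrC.
  by congr (_ + _); rewrite mulr_sumr; apply: eq_bigr => l lj; rewrite YD // mulrC.
have vt_le0 i : cm (w' i) (vt i) <= 0.
  rewrite -(cmean_cst KE muC (w' i) 0); apply: (le_cmean KE muT) => //; first exact: tame_cst.
  by move=> z Kz; rewrite /vt mulr_le0_ge0 ?trunc_ge0 ?(lap1_le0 qE KE cv hv v0).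
have vt_ge i : - (D i / 3) <= cm (w' i) (vt i).
  (* In [lap1_ge_vertex] the factor [1 - h_j] is the sum of the two far coordinates, each with
     truncated mean [D i]; twice 1/6 gives the 1/3. *)
  pose g l : R := - ((l != j i)%:R / 6).
  have <- : cm (w' i) (fun z => \sum_(l < 3) g l * htrunc q l (j i) (c i) z) = - (D i / 3).
    rewrite (cmean_sum KE muT) // sumY /g sum_I3.
    by move: (j i); apply: I3_case => /=; lra.
  apply: (le_cmean KE muT) => //.
    have -> : (fun z => \sum_(l < 3) g l * htrunc q l (j i) (c i) z) = (fun z =>
      g o0 * htrunc q o0 (j i) (c i) z + g o1 * htrunc q o1 (j i) (c i) z
        + g o2 * htrunc q o2 (j i) (c i) z) by apply/funext => z; rewrite sum_I3.
    by apply: tameD; [apply: tameD|]; exact: tameZ.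
  move=> z Kz; have h := lap1_ge_vertex qE KE cv hv v0 (j i) Kz.
  have -> : \sum_(l < 3) g l * htrunc q l (j i) (c i) z =
      - ((1 - hcoord q (j i) z) / 6) * trunc q (j i) (c i) z.
    rewrite (_ : 1 - hcoord q (j i) z = \sum_(l < 3) hcoord q l z - hcoord q (j i) z); last first.
      by rewrite sum_hcoord.
    rewrite /htrunc /g !sum_I3.
    by move: (trunc q _ _ z); move: (j i); apply: I3_case => /= t; lra.
  by rewrite /vt ler_wpM2r ?trunc_ge0.
exists A, D, (cm w v + \sum_(i < 3) (cm (w' i) (vt i) + 2 / 3 * D i)); split.
- by move=> i; rewrite (cmean_htrunc_ge0 qE KE muT muC) (cmean_htrunc_le qE KE muT muC).
- by move=> i; rewrite (cmean_htrunc_ge0 qE KE muT muC) (cmean_htrunc_le qE KE muT muC).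
- have := cmean_lap1_ge qE KE muT muC cv hv v0 w.
  by have := vt_ge o0; have := vt_ge o1; have := vt_ge o2; rewrite !sum_I3 => *; lra.
- have : cm w v <= 0.
    rewrite -(cmean_cst KE muC w 0); apply: (le_cmean KE muT) => //; first exact: tame_cst.
    by move=> z Kz; rewrite (lap1_le0 qE KE cv hv v0).
  by have := vt_le0 o0; have := vt_le0 o1; have := vt_le0 o2; rewrite !sum_I3 => *; lra.
move=> eps f cf hf; rewrite (Rintegral_Bset qE KE muT muC c a cf); congr (_ * _).
have e0 : cm w (f \o Fw q w) = 3^-1 * \sum_(l < 3) f (Fw q w (q l)) + eps * 5 ^- size w * cm w v.
  rewrite (@eq_cmean _ _ _ _ _ _ (fun z => \sum_(l < 3) f (Fw q w (q l)) * hcoord q l z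
    + eps * 5 ^- size w * v z)).
    rewrite (cmeanD KE muT); [|exact: (tame_continuous KE (@within_K_hsum _ _ qE _ KE (fun l => f (Fw q w (q l)))))|exact: tameZ].
    rewrite (cmean_sum KE muT) // (cmeanZ KE muT) //; congr (_ + _).
    rewrite mulr_sumr; apply: eq_bigr => l _; rewrite (cmean_hcoord qE KE muT muC); exact: mulrC.
  by move=> z Kz; exact: (hext_Fw_eq qE KE).
(* Up to the Laplacian term, the far values sum to five times the value at the junction minus the
   sum over the corners of [w]; this is the source of [5 * D l - \sum_(i < 3) D i] in the
   weights. *)
have e1 i : cm (w' i) (fun z => f (Fw q (w' i) z) * trunc q (j i) (c i) z) =
    A i * f (Fw q w (q i)) + D i * (5 * f (Fw q w (q i)) - \sum_(l < 3) f (Fw q w (q l)))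
    + eps * 5 ^- size w * (cm (w' i) (vt i) + 2 / 3 * D i).
  have sw : size (w' i) = size w by rewrite (adj_size (a i)).
  rewrite (@eq_cmean _ _ _ _ _ _ (fun z =>
    \sum_(l < 3) f (Fw q (w' i) (q l)) * htrunc q l (j i) (c i) z + eps * 5 ^- size w * vt i z)).
    rewrite (cmeanD KE muT); [| |exact: tameZ]; last first.
      have -> : (fun z => \sum_(l < 3) f (Fw q (w' i) (q l)) * htrunc q l (j i) (c i) z) =
        (fun z => f (Fw q (w' i) (q o0)) * htrunc q o0 (j i) (c i) z
          + f (Fw q (w' i) (q o1)) * htrunc q o1 (j i) (c i) z
          + f (Fw q (w' i) (q o2)) * htrunc q o2 (j i) (c i) z) by apply/funext => z; rewrite sum_I3.
      by apply: tameD; [apply: tameD|]; exact: tameZ.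
    rewrite (cmean_sum KE muT) // (cmeanZ KE muT) // sumY -(adj_Fw qE (a i)).
    have := hext_adj qE hf (a i); set S := \sum_(l < 3) f (Fw q w (q l)).
    set S' := \sum_(l < 3) _ => e.
    have -> : S' = 6 * f (Fw q w (q i)) + 2 / 3 * eps * 5 ^- size w - S by rewrite -e; ring.
    by ring.
  move=> z Kz; rewrite (hext_Fw_eq qE KE (w' i) cv hv v0 cf hf Kz) sw /vt /htrunc !sum_I3; ring.
by rewrite e0 !sum_I3 !e1 !sum_I3; lra.
Qed.

Lemma mvn_adj x w w' c : mvn q K mu x w w' c -> exists j, forall i, adj w i (w' i) (j i).
Proof.
move=> [_ [hw _]]; suff h i : exists k, adj w i (w' i) k by have [f hf] := choice h; exists f.
have [sw [ww [y Ky e]]] := hw i.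
have [|i' [k [ad qi _]]] := @cell_meet _ _ qE _ KE w (w' i) (q i) y (esym sw) _ (K_q qE KE i) Ky (esym e).
  by rewrite eq_sym.
by exists k; move: ad; rewrite -(q_inj qE KE qi).
Qed.

Lemma hcoord_max_ge y : K y -> exists i, 2 / 5 <= hcoord q i y.
Proof.
move=> /(K_split KE)[i [z [Kz ->]]]; exists i; rewrite (hcoord_F qE KE) // /hstep eqxx sum_hcoord.
by have := hcoord_ge0 q i z => ?; lra.
Qed.

Lemma hext_cst c : hext q 0 (cst c).
Proof. by move=> w i k ik; rewrite sum_I3; lra. Qed.

(** The lower constant is 1/(12 * 16 * 45): the gap is at least 2/3 times 1/30, that is 1/45, and it
    is divided by [12 s^2] with [s <= 4]. *)
Lemma mvn_bounds x w w' c : mvn q K mu x w w' c ->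
  8640^-1 * 5 ^- size w <= meanB mu (Bset q K w w' c) v - v x <= 1 * 5 ^- size w.
Proof.
move=> hB; have [j a] := mvn_adj hB; case: hB => [_ [_ [_ [[y Ky yx] hm]]]].
have [A [D [J [A01 D0 Jge Jle quad]]]] := Bset_quadrature c a.
have A0 i : 0 <= A i by have /andP[] := A01 i.
set T := \sum_(i < 3) D i in Jge Jle quad.
pose g l := 3^-1 + A l + 5 * D l - T.
pose s := \sum_(l < 3) g l.
have s_eq : s = 1 + \sum_(l < 3) (A l + 2 * D l) by rewrite /s /g /T !sum_I3; lra.
have D_bounds i := andP (D0 i).
have s_ge1 : 1 <= s.
  rewrite s_eq lerDl; apply: sumr_ge0 => l _.
  by have [? _] := D_bounds l; have := A0 l => *; lra.
have s0 : 0 < s by lra.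
have p3 : 0 < 3 ^- size w :> R by rewrite invr_gt0 exprn_gt0.
have p5 : 0 < 5 ^- size w :> R by rewrite invr_gt0 exprn_gt0.
have muB : fine (mu (Bset q K w w' c)) = 3 ^- size w * s.
  have mB : measurable (Bset q K w w' c).
    apply: measurableU; first exact: (cell_measurable KE).
    apply: fin_bigcup_measurable => // i _; apply: (Eset_measurable qE KE (j := j i)).
      by rewrite (adj_size (a i)).
    exact: adj_Fw.
  (* The mass is the quadrature of the constant 1, so the normalizing factor is the total weight
     [s]. *)
  rewrite -[LHS]mul1r -(Rintegral_cst mu mB) (quad 0 (cst 1)).
  - by rewrite !mul0r addr0 /s; congr (_ * _); apply: eq_bigr => l _; rewrite mulr1.
  - by move=> z; exact: cvg_cst.
  - exact: hext_cst.
have mean (eps : R) (f : pt -> R) : {within K, continuous f} -> hext q eps f ->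
    meanB mu (Bset q K w w' c) f =
    s^-1 * (\sum_(l < 3) g l * f (Fw q w (q l)) + eps * 5 ^- size w * J).
  move=> cf hf; rewrite /meanB muB (quad eps f cf hf) invfM mulrA; congr (_ * _).
  by rewrite mulrAC mulVf ?mul1r // lt0r_neq0.
(* The mean value property of the three harmonic coordinates says that the weights [g] and [s * h]
   give the same values; [hcoord_det] then identifies them. *)
have gE l : g l = s * hcoord q l y.
  apply/eqP; rewrite -subr_eq0; apply/eqP; move: l.
  apply: (hcoord_det qE KE (w := w) (g := fun l => g l - s * hcoord q l y)) => m.
  have := hm _ (harmonic_hcoord qE KE m).
  rewrite (mean 0 (hcoord q m) (@hcoord_continuous _ _ qE _ KE m) (hext_hcoord qE KE m)) !mul0r addr0.
  rewrite -yx (hcoord_Fw qE KE m w Ky) => e.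
  have {}e : \sum_(l < 3) g l * hcoord q m (Fw q w (q l)) =
      s * \sum_(l < 3) hcoord q l y * hcoord q m (Fw q w (q l)).
    by rewrite -e mulrA mulfV ?mul1r // lt0r_neq0.
  under eq_bigr do rewrite mulrBl -mulrA.
  by rewrite sumrB e mulr_sumr subrr.
have diff : meanB mu (Bset q K w w' c) v - v x = (J / s - v y) * 5 ^- size w.
  rewrite (mean 1) // -yx (hext_Fw_eq qE KE w cv hv v0 cv hv Ky).
  have -> : \sum_(l < 3) g l * v (Fw q w (q l)) =
      s * \sum_(l < 3) v (Fw q w (q l)) * hcoord q l y.
    by rewrite mulr_sumr; apply: eq_bigr => l _; rewrite gE; ring.
  by field; rewrite !lt0r_neq0 // exprn_gt0.
rewrite diff !ler_pM2r //.
have gap := mean_value_gap A0 D0 (erefl T) (erefl s) (fun i => erefl (g i)).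
set S := \sum_(i < 3) (A i + 2 * D i) in gap s_eq.
have g2 : \sum_(i < 3) g i ^+ 2 = s ^+ 2 * \sum_(i < 3) hcoord q i y ^+ 2.
  by rewrite mulr_sumr; apply: eq_bigr => i _; rewrite gE exprMn.
have vle := lap1_le qE KE cv hv v0 Ky; have vge := lap1_ge qE KE cv hv v0 Ky.
(* From [2 / 5 <= g i] and [D i <= T] follows [1 / 15 <= A i + 4 * D i], which is at most twice
   [A i + 2 * D i]. *)
have S_ge : 30^-1 <= S.
  have [i hi] := hcoord_max_ge Ky.
  have h1 : 2 / 5 <= g i by rewrite gE; apply: le_trans hi _; rewrite ler_peMl // hcoord_ge0.
  have AD l : 0 <= A l + 2 * D l by have [? _] := D_bounds l; have := A0 l => *; lra.
  have h2 : A i + 2 * D i <= S by rewrite /S (bigD1 i) //= lerDl sumr_ge0.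
  have h3 : D i <= T by rewrite /T (bigD1 i) //= lerDl sumr_ge0 // => l _; have [] := D_bounds l.
  by rewrite /g in h1; have := A0 i => ?; lra.
have S_le : S <= 3.
  rewrite /S sum_I3; have /andP[_ ?] := A01 o0; have /andP[_ ?] := A01 o1; have /andP[_ ?] := A01 o2.
  have [_ ?] := D_bounds o0; have [_ ?] := D_bounds o1; have [_ ?] := D_bounds o2; lra.
have T_le : T <= 1.
  rewrite /T sum_I3; have [_ ?] := D_bounds o0; have [_ ?] := D_bounds o1.
  by have [_ ?] := D_bounds o2; lra.
rewrite g2 in gap; move: gap vle vge; set Q := \sum_(i < 3) hcoord q i y ^+ 2 => gap vle vge.
apply/andP; split; last first.
  (* Together with [- 12^-1 <= v y] this bounds the normalized difference by 3/4. *)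
  have : J / s <= 2 / 3 by rewrite ler_pdivrMr //; lra.
  by move=> ?; lra.
have s2 : 0 < 12 * s ^+ 2 by rewrite mulr_gt0 // exprn_gt0.
rewrite -(ler_pM2l s2) (_ : 12 * s ^+ 2 * (J / s - v y) = 12 * (s * J) - 12 * (s ^+ 2 * v y)); last first.
  by field; rewrite lt0r_neq0.
have e1 : s * (3^-1 * T - 18^-1) <= s * J by rewrite ler_pM2l.
have e2 : s ^+ 2 * v y <= s ^+ 2 * - ((1 - Q) / 12) by rewrite ler_pM2l // exprn_gt0.
have e3 : s ^+ 2 <= 4 ^+ 2 by rewrite lerXn2r ?nnegrE //; lra.
lra.
Qed.

End Quadrature.

Theorem theorem4p1 (R : realType) (q : 'I_3 -> (R * R)%type) (K : set (R * R))
  (mu : {measure set (R * R) -> \bar R}) (v : R * R -> R) :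
  equilateral q -> is_SG q K ->
  mu setT = 1%E -> (forall w : seq 'I_3, mu (cell q K w) = ((3 ^- size w)%:E)) ->
  has_lap q K mu v (fun _ => 1) -> (forall i, v (q i) = 0) ->
  exists c0 c1 : R, 0 < c0 <= c1 /\
    forall (x : R * R) (w : seq 'I_3) (w' : 'I_3 -> seq 'I_3) (c : 'I_3 -> R),
      K x -> (forall i, x <> q i) ->
      mvn q K mu x w w' c ->
      c0 * 5 ^- size w <= meanB mu (Bset q K w w' c) v - v x <= c1 * 5 ^- size w.
Proof.
move=> qE KE muT muC lv v0; exists 8640^-1, 1; split; first lra.
move=> x w w' c _ _; have [_ [[cv _] _]] := lv.
exact: (mvn_bounds qE KE muT muC cv (hext_lap1 qE KE muT muC lv) v0).
Qed.
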